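(* Let $(G,g)$ be a $4$-dimensional Lie group with a left-invariant Riemannian metric, let $\mathcal F$ be a $2$-dimensional left-invariant conformal foliation on $G$ with minimal leaves, and let $J$ be a left-invariant almost Hermitian structure on $(G,g)$ adapted to $\mathcal F$. Let $\mathcal V$ be the distribution tangent to $\mathcal F$, let $\mathfrak g$ be the Lie algebra of $G$ and $\mathfrak k\subset\mathfrak g$ the $2$-dimensional subalgebra generating $\mathcal V$. In the lists below, $X,Y,Z,W$ denotes an orthonormal basis of $\mathfrak g$ with $Z,W\in\mathfrak k$, $X,Y\in\mathfrak k^{\perp}$, $J(X)=Y$ and $J(Z)=W$. All parameters are real, and brackets of basis vectors that are not listed (and not determined by skew-symmetry) are zero. **(AK)** If $J$ is almost Kähler, then there is such a basis for which the bracket relations of $\mathfrak g$ are those of one of the following families. - $\mathfrak g_1^{\mathcal{AK}}(\lambda,r,w_2)$, $\lambda\ne0$, $r\neq 0$: $[W,Z]=\lambda W$, $[Z,Y]=w_2W$, $[Y,X]=rX$. - $\mathfrak g_2^{\mathcal{AK}}(\lambda,\beta,w_1,w_2)$, $\lambda\neq0$: $[W,Z]=\lambda W$, $[Z,X]=\beta Y+w_1W$, $[Z,Y]=-\beta X+w_2W$. - $\mathfrak g_3^{\mathcal{AK}}(\alpha,\beta,w_1,w_2)$, $\alpha\neq0$: $[W,Z]=-2\alpha W$, $[Z,X]=\alpha X+\beta Y+w_1W$, $[Z,Y]=-\beta X+\alpha Y+w_2W$, $[Y,X]=-2\alpha W$. - $\mathfrak g_4^{\mathcal{AK}}(\lambda,z_2,w_2)$,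 $\lambda\ne0$, $z_2\neq0$: $[W,Z]=\lambda W$, $[Z,X]=\lambda X+\frac{2\lambda^2}{z_2}W$, $[Z,Y]=\lambda Y+z_2Z+w_2W$, $[W,Y]=-z_2W$, $[Y,X]=-z_2X-2\lambda W$. - $\mathfrak g_5^{\mathcal{AK}}(\alpha,a,\beta,b)^{\pm}$, with $D=\alpha b-a\beta>0$ (two families, one for the upper and one for the lower signs): $[Z,X]=\alpha X+\beta Y\mp\frac{\beta b-\alpha a}{\sqrt D}Z\mp\frac{\alpha^2-\beta^2}{\sqrt D}W$, $[Z,Y]=-\beta X+\alpha Y\mp\frac{\alpha b+\beta a}{\sqrt D}Z\pm\frac{2\alpha\beta}{\sqrt D}W$, $[W,X]=aX+bY\mp\frac{b^2-a^2}{\sqrt D}Z\mp\frac{\alpha a-\beta b}{\sqrt D}W$, $[W,Y]=-bX+aY\mp\frac{2ab}{\sqrt D}Z\pm\frac{\alpha b+\beta a}{\sqrt D}W$, $[Y,X]=\pm2\sqrt D\,X+2aZ-2\alpha W$. - $\mathfrak g_6^{\mathcal{AK}}(z_1,z_2,z_3,r)$, $z_1,z_3,r\neq0$: $[Z,X]=z_1Z-\frac{z_1^2}{z_3}W$, $[Z,Y]=z_2Z+\frac{z_1(r-2z_2)}{2z_3}W$, $[W,X]=z_3Z-z_1W$, $[W,Y]=\frac{z_3(r+2z_2)}{2z_1}Z-z_2W$, $[Y,X]=rX$. - $\mathfrak g_7^{\mathcal{AK}}(z_2,w_1,w_2)$, $z_2,w_1\neq0$: $[Z,X]=w_1W$,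 $[Z,Y]=z_2Z+w_2W$, $[W,Y]=-z_2W$, $[Y,X]=2z_2X$. - $\mathfrak g_8^{\mathcal{AK}}(z_2,z_4,w_2,r)$, $r\neq0$: $[Z,Y]=z_2Z+w_2W$, $[W,Y]=z_4Z-z_2W$, $[Y,X]=rX$. - $\mathfrak g_9^{\mathcal{AK}}(z_2,z_3,z_4)$, $z_2,z_3\neq0$: $[Z,Y]=z_2Z$, $[W,X]=z_3Z$, $[W,Y]=z_4Z-z_2W$, $[Y,X]=-2z_2X$. - $\mathfrak g_{11}^{\mathcal{AK}}(z_1,z_2,z_3,w_1)$, $z_1\neq0$: $[Z,X]=z_1Z+w_1W$, $[Z,Y]=z_2Z+\frac{z_2w_1}{z_1}W$, $[W,X]=z_3Z-z_1W$, $[W,Y]=\frac{z_2z_3}{z_1}Z-z_2W$. - $\mathfrak g_{12}^{\mathcal{AK}}(z_3,w_1,w_2)$, $w_1\neq0$: $[Z,X]=w_1W$, $[Z,Y]=w_2W$, $[W,X]=z_3Z$, $[W,Y]=\frac{z_3w_2}{w_1}Z$. - $\mathfrak g_{13}^{\mathcal{AK}}(z_3,z_4)$, $z_3\neq0$: $[W,X]=z_3Z$, $[W,Y]=z_4Z$. - $\mathfrak g_{14}^{\mathcal{AK}}(z_2,z_4,w_2)$: $[Z,Y]=z_2Z+w_2W$, $[W,Y]=z_4Z-z_2W$. - $\mathfrak g_{16}^{\mathcal{AK}}(\beta,w_1,w_2)$, $\beta\neq0$: $[Z,X]=\beta Y+w_1W$, $[Z,Y]=-\beta X+w_2W$. -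 $\mathfrak g_{18}^{\mathcal{AK}}(\beta,b,z_3,z_4)$, $\beta,b\neq0$: $[Z,X]=\beta Y+\frac{\beta z_3}{b}Z-\frac{\beta^2z_3}{b^2}W$, $[Z,Y]=-\beta X+\frac{\beta z_4}{b}Z-\frac{\beta^2z_4}{b^2}W$, $[W,X]=bY+z_3Z-\frac{\beta z_3}{b}W$, $[W,Y]=-bX+z_4Z-\frac{\beta z_4}{b}W$. **(I)** If $J$ is integrable, then there is such a basis for which the bracket relations of $\mathfrak g$ are those of one of the following families. - $\mathfrak g_1^{\mathcal I}(\lambda,r)$, $\lambda,r\neq0$: $[W,Z]=\lambda W$, $[Y,X]=rX$. - $\mathfrak g_2^{\mathcal I}(\lambda,\alpha,\beta)$, $\lambda\neq0$, $(\lambda-\alpha)^2+\beta^2\neq0$: $[W,Z]=\lambda W$, $[Z,X]=\alpha X+\beta Y$, $[Z,Y]=-\beta X+\alpha Y$. - $\mathfrak g_3^{\mathcal I}(\alpha,\beta,\theta_2)$, $\alpha,\theta_2\neq0$: $[W,Z]=-2\alpha W$, $[Z,X]=\alpha X+\beta Y$, $[Z,Y]=-\beta X+\alpha Y$, $[Y,X]=\theta_2W$. - $\mathfrak g_4^{\mathcal I}(\lambda,z_2)$, $\lambda\neq0$: $[W,Z]=\lambda W$, $[Z,X]=\lambda X-2z_2W$, $[Z,Y]=\lambda Y+z_2Z$, $[W,Y]=-z_2W$, $[Y,X]=-z_2X+\frac{2z_2^2}{\lambda}W$. - $\mathfrak g_5^{\mathcal I}(\alpha,\beta,r)$, with $r\neq0$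 and $S=\alpha^2+\beta^2\neq0$: $[Z,X]=\alpha X+\beta Y-\frac{r\alpha\beta}{S}Z+\frac{r(\alpha^2-\beta^2)}{2S}W$, $[Z,Y]=-\beta X+\alpha Y-\frac{r(\alpha^2-\beta^2)}{2S}Z-\frac{r\alpha\beta}{S}W$, $[W,X]=\beta X-\alpha Y+\frac{r(\alpha^2-\beta^2)}{2S}Z+\frac{r\alpha\beta}{S}W$, $[W,Y]=\alpha X+\beta Y-\frac{r\alpha\beta}{S}Z+\frac{r(\alpha^2-\beta^2)}{2S}W$, $[Y,X]=rX-\frac{\beta r^2}{2S}Z+\frac{\alpha r^2}{2S}W$. - $\mathfrak g_6^{\mathcal I}(z_1,z_3,\theta_1,\theta_2)$, $z_1,z_3\neq0$: $[Z,X]=z_1Z-\frac{z_1^2}{z_3}W$, $[Z,Y]=\frac{z_1^2-z_3^2}{2z_3}Z+z_1W$, $[W,X]=z_3Z-z_1W$, $[W,Y]=z_1Z-\frac{z_1^2-z_3^2}{2z_3}W$, $[Y,X]=\frac{z_1^2+z_3^2}{z_3}X+\theta_1Z+\theta_2W$. - $\mathfrak g_7^{\mathcal I}(z_2,\theta_1,\theta_2)$, $z_2\neq0$: $[Z,X]=-2z_2W$, $[Z,Y]=z_2Z$, $[W,Y]=-z_2W$, $[Y,X]=2z_2X+\theta_1Z+\theta_2W$. - $\mathfrak g_8^{\mathcal I}(w_2,r,\theta_1,\theta_2)$, $r\neq0$: $[Z,Y]=w_2W$, $[W,Y]=-w_2Z$, $[Y,X]=rX+\theta_1Z+\theta_2W$.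 - $\mathfrak g_9^{\mathcal I}(z_2,\theta_1,\theta_2)$, $z_2\neq0$: $[Z,Y]=z_2Z$, $[W,X]=-2z_2Z$, $[W,Y]=-z_2W$, $[Y,X]=-2z_2X+\theta_1Z+\theta_2W$. - $\mathfrak g_{10}^{\mathcal I}(\alpha,a,\beta,b)$, $\alpha b-a\beta\neq0$: $[Z,X]=\alpha X+\beta Y$, $[Z,Y]=-\beta X+\alpha Y$, $[W,X]=aX+bY$, $[W,Y]=-bX+aY$. - $\mathfrak g_{12}^{\mathcal I}(w_1,w_2,\theta_1,\theta_2)$, $w_1\neq0$: $[Z,X]=w_1W$, $[Z,Y]=w_2W$, $[W,X]=-w_1Z$, $[W,Y]=-w_2Z$, $[Y,X]=\theta_1Z+\theta_2W$. - $\mathfrak g_{14}^{\mathcal I}(w_2,\theta_1,\theta_2)$: $[Z,Y]=w_2W$, $[W,Y]=-w_2Z$, $[Y,X]=\theta_1Z+\theta_2W$. - $\mathfrak g_{15}^{\mathcal I}(\alpha)$, $\alpha\neq0$: $[Z,X]=\alpha X$, $[Z,Y]=\alpha Y$. - $\mathfrak g_{16}^{\mathcal I}(\beta,\theta_1,\theta_2)$, $\beta\neq0$: $[Z,X]=\beta Y$, $[Z,Y]=-\beta X$, $[Y,X]=\theta_1Z+\theta_2W$. - $\mathfrak g_{17}^{\mathcal I}(\alpha,a)$, $\alpha,a\neq0$: $[Z,X]=\alpha X$, $[Z,Y]=\alpha Y$, $[W,X]=aX$, $[W,Y]=aY$. - $\mathfrak g_{18}^{\mathcal I}(\beta,b,\theta_1,\theta_2)$,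 $\beta,b\neq0$: $[Z,X]=\beta Y$, $[Z,Y]=-\beta X$, $[W,X]=bY$, $[W,Y]=-bX$, $[Y,X]=\theta_1Z+\theta_2W$. - $\mathfrak g_{19}^{\mathcal I}(\alpha,\beta)$, $\alpha,\beta\neq0$: $[Z,X]=\alpha X+\beta Y$, $[Z,Y]=-\beta X+\alpha Y$. - $\mathfrak g_{20}^{\mathcal I}(\alpha,a,\beta)$, $\alpha,a,\beta\neq0$: $[Z,X]=\alpha X+\beta Y$, $[Z,Y]=-\beta X+\alpha Y$, $[W,X]=aX+\frac{\beta a}{\alpha}Y$, $[W,Y]=-\frac{\beta a}{\alpha}X+aY$. **(K)** If $J$ is Kähler, then there is such a basis for which the bracket relations of $\mathfrak g$ are those of one of the following families. - $\mathfrak g_1^{\mathcal K}(\lambda,r)$, $\lambda,r\neq0$: $[W,Z]=\lambda W$, $[Y,X]=rX$. - $\mathfrak g_2^{\mathcal K}(\lambda,\beta)$, $\lambda\neq0$: $[W,Z]=\lambda W$, $[Z,X]=\beta Y$, $[Z,Y]=-\beta X$. - $\mathfrak g_3^{\mathcal K}(\alpha,\beta)$, $\alpha\neq0$: $[W,Z]=-2\alpha W$, $[Z,X]=\alpha X+\beta Y$, $[Z,Y]=-\beta X+\alpha Y$, $[Y,X]=-2\alpha W$. - $\mathfrak g_6^{\mathcal K}(z_1,z_3)$, $z_1,z_3\neq0$: $[Z,X]=z_1Z-\frac{z_1^2}{z_3}W$, $[Z,Y]=\frac{z_1^2-z_3^2}{2z_3}Z+z_1W$, $[W,X]=z_3Z-z_1W$,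 $[W,Y]=z_1Z-\frac{z_1^2-z_3^2}{2z_3}W$, $[Y,X]=\frac{z_1^2+z_3^2}{z_3}X$. - $\mathfrak g_7^{\mathcal K}(z_2)$, $z_2\neq0$: $[Z,X]=-2z_2W$, $[Z,Y]=z_2Z$, $[W,Y]=-z_2W$, $[Y,X]=2z_2X$. - $\mathfrak g_8^{\mathcal K}(w_2,r)$, $r\neq0$: $[Z,Y]=w_2W$, $[W,Y]=-w_2Z$, $[Y,X]=rX$. - $\mathfrak g_9^{\mathcal K}(z_2)$, $z_2\neq0$: $[Z,Y]=z_2Z$, $[W,X]=-2z_2Z$, $[W,Y]=-z_2W$, $[Y,X]=-2z_2X$. - $\mathfrak g_{12}^{\mathcal K}(w_1,w_2)$, $w_1\neq0$: $[Z,X]=w_1W$, $[Z,Y]=w_2W$, $[W,X]=-w_1Z$, $[W,Y]=-w_2Z$. - $\mathfrak g_{14}^{\mathcal K}(w_2)$: $[Z,Y]=w_2W$, $[W,Y]=-w_2Z$. - $\mathfrak g_{16}^{\mathcal K}(\beta)$, $\beta\neq0$: $[Z,X]=\beta Y$, $[Z,Y]=-\beta X$. - $\mathfrak g_{18}^{\mathcal K}(\beta,b)$, $\beta,b\neq0$: $[Z,X]=\beta Y$, $[Z,Y]=-\beta X$, $[W,X]=bY$, $[W,Y]=-bX$.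
   Context: Left-invariant foliation: $\mathfrak k$ is a $2$-dimensional subalgebra of the Lie algebra $\mathfrak g$ of $G$ (the Lie algebra of a $2$-dimensional subgroup $K$), $\mathcal V$ is the integrable left-invariant distribution generated by $\mathfrak k$, $\mathcal H$ is its orthogonal complement (generated by $\mathfrak m=\mathfrak k^\perp$), and $\mathcal F$ is the foliation tangent to $\mathcal V$. The symbols $\mathcal V,\mathcal H$ also denote the orthogonal projections of $TG$ onto these distributions, and $\nabla$ is the Levi-Civita connection of $g$. The second fundamental forms are $B^{\mathcal V}(E,F)=\frac12\mathcal H(\nabla_EF+\nabla_FE)$ for $E,F\in\mathcal V$, and $B^{\mathcal H}(E,F)=\frac12\mathcal V(\nabla_EF+\nabla_FE)$ for $E,F\in\mathcal H$. The foliation $\mathcal F$ is conformal if there is a vector field $V\in\mathcal V$ with $B^{\mathcal H}=g\otimes V$. It has minimal leaves if $\operatorname{trace}B^{\mathcal V}=0$. A left-invariant almost Hermitian structure $J$ on $(G,g)$ (a left-invariant bundle isomorphism $J:TG\to TG$ with $J^2=-\mathrm{id}$, orthogonal with respect to $g$) is adapted to $\mathcal F$ if $J(\mathcal V)=\mathcal V$ and $J(\mathcal H)=\mathcal H$. Let $\omega(E,F)=g(JE,F)$ be the Kähler form. The structure $J$ is almost Kähler $(\mathcal{AK})$ if $d\omega=0$. It is integrable $(\mathcal I)$ if the Nijenhuis tensor $N(E,F)=[E,F]+J[JE,F]+J[E,JF]-[JE,JF]$ vanishes identically. It is Kähler $(\mathcal K)$ if it is both almost Kähler and integrable. *)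

(* Defs.v *)
From HB Require Import structures.
From mathcomp Require Import all_boot all_order all_algebra reals.

Set Implicit Arguments.
Unset Strict Implicit.
Unset Printing Implicit Defensive.

Import Order.TTheory GRing.Theory Num.Theory.

Local Open Scope ring_scope.

(* Left-invariant geometry of a Lie group (G, g), written on its Lie algebra.
   V is the space of left-invariant vector fields with Lie bracket br, and a
   left-invariant tensor field is the corresponding multilinear map on V.  In
   particular the left-invariant Riemannian metric is a positive definite
   symmetric form on V, a left-invariant distribution is a subspace of V, and
   the function g(E, F) is constant on G when E, F are left-invariant, so
   derivatives of such functions vanish in the formulas below. *)

Section LeftInvariantGeometry.
Variables (R : realType) (V : vectType R).
Variables (br : {bilinear V -> V -> V}) (g : {dot V for idfun}).
Variables (nabla : {bilinear V -> V -> V}) (k : {vspace V}) (J : 'End(V)).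

Definition lie_bracket : Prop :=
  (forall x, br x x = 0) /\
  (forall x y z, br x (br y z) + br y (br z x) + br z (br x y) = 0).

Definition subalgebra : Prop := forall x y, x \in k -> y \in k -> br x y \in k.

(* Torsion-free and metric; E (g(F, H)) = 0 for left-invariant E, F, H. *)
Definition levi_civita : Prop :=
  (forall E F, nabla E F - nabla F E = br E F) /\
  (forall E F H, g (nabla E F) H + g F (nabla E H) = 0).

Definition horizontal : {vspace V} := orthov g k.

Definition vproj : 'End(V) := daddv_pi k horizontal.
Definition hproj : 'End(V) := daddv_pi horizontal k.

(* The second fundamental forms; B_V is meant on k, B_H on its complement. *)
Definition B_V (E F : V) : V := 2^-1 *: hproj (nabla E F + nabla F E).
Definition B_H (E F : V) : V := 2^-1 *: vproj (nabla E F + nabla F E).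

(* A vector field U tangent to k with B_H = g (x) U is left-invariant, because
   U = B_H(E, E) for every left-invariant horizontal unit field E. *)
Definition conformal_foliation : Prop :=
  exists2 U, U \in k &
    forall E F, E \in horizontal -> F \in horizontal -> B_H E F = g E F *: U.

Definition minimal_leaves : Prop :=
  forall e : seq V, basis_of k e -> orthonormal g e ->
    \sum_(E <- e) B_V E E = 0.

Definition almost_hermitian : Prop :=
  (forall E, J (J E) = - E) /\ (forall E F, g (J E) (J F) = g E F).

Definition adapted : Prop :=
  (J @: k = k)%VS /\ (J @: horizontal = horizontal)%VS.

Definition kahler_form (E F : V) : R := g (J E) F.

(* Exterior derivative of a left-invariant 2-form: the terms E (om(F, H)) of
   the invariant formula vanish. *)
Definition ext_deriv (om : V -> V -> R) (E F H : V) : R :=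
  - om (br E F) H + om (br E H) F - om (br F H) E.

Definition almost_kahler : Prop :=
  forall E F H, ext_deriv kahler_form E F H = 0.

Definition nijenhuis (E F : V) : V :=
  br E F + J (br (J E) F) + J (br E (J F)) - br (J E) (J F).

Definition integrable : Prop := forall E F, nijenhuis E F = 0.

Definition kahler : Prop := almost_kahler /\ integrable.

Definition adapted_basis (X Y Z W : V) : Prop :=
  [/\ basis_of fullv [:: X; Y; Z; W] /\ orthonormal g [:: X; Y; Z; W],
      Z \in k /\ W \in k, X \in horizontal /\ Y \in horizontal,
      J X = Y & J Z = W].

End LeftInvariantGeometry.

Section Families.
Variables (R : realType) (V : vectType R) (br : V -> V -> V) (X Y Z W : V).

Definition bracket_relations (wz zx zy wx wy yx : V) : Prop :=
  (br W Z = wz /\ br Z X = zx) /\ (br Z Y = zy /\ br W X = wx) /\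
  (br W Y = wy /\ br Y X = yx).

(* In each family the brackets are listed in the order
   [W,Z], [Z,X], [Z,Y], [W,X], [W,Y], [Y,X]. *)

(* In AK_g5, s = false gives the upper signs and s = true the lower ones. *)
Inductive AK_family : Prop :=
| AK_g1 (lam r w2 : R) of lam != 0 & r != 0 & bracket_relations
    (lam *: W)
    0
    (w2 *: W)
    0
    0
    (r *: X)
| AK_g2 (lam be w1 w2 : R) of lam != 0 & bracket_relations
    (lam *: W)
    (be *: Y + w1 *: W)
    (- be *: X + w2 *: W)
    0
    0
    0
| AK_g3 (al be w1 w2 : R) of al != 0 & bracket_relations
    (- (2 * al) *: W)
    (al *: X + be *: Y + w1 *: W)
    (- be *: X + al *: Y + w2 *: W)
    0
    0
    (- (2 * al) *: W)
| AK_g4 (lam z2 w2 : R) of lam != 0 & z2 != 0 & bracket_relations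
    (lam *: W)
    (lam *: X + (2 * lam ^+ 2 / z2) *: W)
    (lam *: Y + z2 *: Z + w2 *: W)
    0
    (- z2 *: W)
    (- z2 *: X - (2 * lam) *: W)
| AK_g5 (s : bool) (al a be b : R) (D := al * b - a * be) (e := (-1) ^+ s : R)
    of 0 < D & bracket_relations
    0
    (al *: X + be *: Y - (e * (be * b - al * a) / Num.sqrt D) *: Z
       - (e * (al ^+ 2 - be ^+ 2) / Num.sqrt D) *: W)
    (- be *: X + al *: Y - (e * (al * b + be * a) / Num.sqrt D) *: Z
       + (e * (2 * al * be) / Num.sqrt D) *: W)
    (a *: X + b *: Y - (e * (b ^+ 2 - a ^+ 2) / Num.sqrt D) *: Z
       - (e * (al * a - be * b) / Num.sqrt D) *: W)
    (- b *: X + a *: Y - (e * (2 * a * b) / Num.sqrt D) *: Z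
       + (e * (al * b + be * a) / Num.sqrt D) *: W)
    ((e * (2 * Num.sqrt D)) *: X + (2 * a) *: Z - (2 * al) *: W)
| AK_g6 (z1 z2 z3 r : R) of z1 != 0 & z3 != 0 & r != 0 & bracket_relations
    0
    (z1 *: Z - (z1 ^+ 2 / z3) *: W)
    (z2 *: Z + (z1 * (r - 2 * z2) / (2 * z3)) *: W)
    (z3 *: Z - z1 *: W)
    ((z3 * (r + 2 * z2) / (2 * z1)) *: Z - z2 *: W)
    (r *: X)
| AK_g7 (z2 w1 w2 : R) of z2 != 0 & w1 != 0 & bracket_relations
    0
    (w1 *: W)
    (z2 *: Z + w2 *: W)
    0
    (- z2 *: W)
    ((2 * z2) *: X)
| AK_g8 (z2 z4 w2 r : R) of r != 0 & bracket_relations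
    0
    0
    (z2 *: Z + w2 *: W)
    0
    (z4 *: Z - z2 *: W)
    (r *: X)
| AK_g9 (z2 z3 z4 : R) of z2 != 0 & z3 != 0 & bracket_relations
    0
    0
    (z2 *: Z)
    (z3 *: Z)
    (z4 *: Z - z2 *: W)
    (- (2 * z2) *: X)
| AK_g11 (z1 z2 z3 w1 : R) of z1 != 0 & bracket_relations
    0
    (z1 *: Z + w1 *: W)
    (z2 *: Z + (z2 * w1 / z1) *: W)
    (z3 *: Z - z1 *: W)
    ((z2 * z3 / z1) *: Z - z2 *: W)
    0
| AK_g12 (z3 w1 w2 : R) of w1 != 0 & bracket_relations
    0
    (w1 *: W)
    (w2 *: W)
    (z3 *: Z)
    ((z3 * w2 / w1) *: Z)
    0
| AK_g13 (z3 z4 : R) of z3 != 0 & bracket_relations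
    0
    0
    0
    (z3 *: Z)
    (z4 *: Z)
    0
| AK_g14 (z2 z4 w2 : R) of bracket_relations
    0
    0
    (z2 *: Z + w2 *: W)
    0
    (z4 *: Z - z2 *: W)
    0
| AK_g16 (be w1 w2 : R) of be != 0 & bracket_relations
    0
    (be *: Y + w1 *: W)
    (- be *: X + w2 *: W)
    0
    0
    0
| AK_g18 (be b z3 z4 : R) of be != 0 & b != 0 & bracket_relations
    0
    (be *: Y + (be * z3 / b) *: Z - (be ^+ 2 * z3 / b ^+ 2) *: W)
    (- be *: X + (be * z4 / b) *: Z - (be ^+ 2 * z4 / b ^+ 2) *: W)
    (b *: Y + z3 *: Z - (be * z3 / b) *: W)
    (- b *: X + z4 *: Z - (be * z4 / b) *: W)
    0.

Inductive I_family : Prop :=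
| I_g1 (lam r : R) of lam != 0 & r != 0 & bracket_relations
    (lam *: W)
    0
    0
    0
    0
    (r *: X)
| I_g2 (lam al be : R)
    of lam != 0 & (lam - al) ^+ 2 + be ^+ 2 != 0 & bracket_relations
    (lam *: W)
    (al *: X + be *: Y)
    (- be *: X + al *: Y)
    0
    0
    0
| I_g3 (al be th2 : R) of al != 0 & th2 != 0 & bracket_relations
    (- (2 * al) *: W)
    (al *: X + be *: Y)
    (- be *: X + al *: Y)
    0
    0
    (th2 *: W)
| I_g4 (lam z2 : R) of lam != 0 & bracket_relations
    (lam *: W)
    (lam *: X - (2 * z2) *: W)
    (lam *: Y + z2 *: Z)
    0
    (- z2 *: W)
    (- z2 *: X + (2 * z2 ^+ 2 / lam) *: W)
| I_g5 (al be r : R) (S := al ^+ 2 + be ^+ 2)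
    of r != 0 & S != 0 & bracket_relations
    0
    (al *: X + be *: Y - (r * al * be / S) *: Z
       + (r * (al ^+ 2 - be ^+ 2) / (2 * S)) *: W)
    (- be *: X + al *: Y - (r * (al ^+ 2 - be ^+ 2) / (2 * S)) *: Z
       - (r * al * be / S) *: W)
    (be *: X - al *: Y + (r * (al ^+ 2 - be ^+ 2) / (2 * S)) *: Z
       + (r * al * be / S) *: W)
    (al *: X + be *: Y - (r * al * be / S) *: Z
       + (r * (al ^+ 2 - be ^+ 2) / (2 * S)) *: W)
    (r *: X - (be * r ^+ 2 / (2 * S)) *: Z + (al * r ^+ 2 / (2 * S)) *: W)
| I_g6 (z1 z3 th1 th2 : R) of z1 != 0 & z3 != 0 & bracket_relations
    0
    (z1 *: Z - (z1 ^+ 2 / z3) *: W)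
    (((z1 ^+ 2 - z3 ^+ 2) / (2 * z3)) *: Z + z1 *: W)
    (z3 *: Z - z1 *: W)
    (z1 *: Z - ((z1 ^+ 2 - z3 ^+ 2) / (2 * z3)) *: W)
    (((z1 ^+ 2 + z3 ^+ 2) / z3) *: X + th1 *: Z + th2 *: W)
| I_g7 (z2 th1 th2 : R) of z2 != 0 & bracket_relations
    0
    (- (2 * z2) *: W)
    (z2 *: Z)
    0
    (- z2 *: W)
    ((2 * z2) *: X + th1 *: Z + th2 *: W)
| I_g8 (w2 r th1 th2 : R) of r != 0 & bracket_relations
    0
    0
    (w2 *: W)
    0
    (- w2 *: Z)
    (r *: X + th1 *: Z + th2 *: W)
| I_g9 (z2 th1 th2 : R) of z2 != 0 & bracket_relations
    0
    0
    (z2 *: Z)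
    (- (2 * z2) *: Z)
    (- z2 *: W)
    (- (2 * z2) *: X + th1 *: Z + th2 *: W)
| I_g10 (al a be b : R) of al * b - a * be != 0 & bracket_relations
    0
    (al *: X + be *: Y)
    (- be *: X + al *: Y)
    (a *: X + b *: Y)
    (- b *: X + a *: Y)
    0
| I_g12 (w1 w2 th1 th2 : R) of w1 != 0 & bracket_relations
    0
    (w1 *: W)
    (w2 *: W)
    (- w1 *: Z)
    (- w2 *: Z)
    (th1 *: Z + th2 *: W)
| I_g14 (w2 th1 th2 : R) of bracket_relations
    0
    0
    (w2 *: W)
    0
    (- w2 *: Z)
    (th1 *: Z + th2 *: W)
| I_g15 (al : R) of al != 0 & bracket_relations
    0
    (al *: X)
    (al *: Y)
    0
    0
    0
| I_g16 (be th1 th2 : R) of be != 0 & bracket_relations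
    0
    (be *: Y)
    (- be *: X)
    0
    0
    (th1 *: Z + th2 *: W)
| I_g17 (al a : R) of al != 0 & a != 0 & bracket_relations
    0
    (al *: X)
    (al *: Y)
    (a *: X)
    (a *: Y)
    0
| I_g18 (be b th1 th2 : R) of be != 0 & b != 0 & bracket_relations
    0
    (be *: Y)
    (- be *: X)
    (b *: Y)
    (- b *: X)
    (th1 *: Z + th2 *: W)
| I_g19 (al be : R) of al != 0 & be != 0 & bracket_relations
    0
    (al *: X + be *: Y)
    (- be *: X + al *: Y)
    0
    0
    0
| I_g20 (al a be : R) of al != 0 & a != 0 & be != 0 & bracket_relations
    0
    (al *: X + be *: Y)
    (- be *: X + al *: Y)
    (a *: X + (be * a / al) *: Y)
    (- (be * a / al) *: X + a *: Y)
    0.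

Inductive K_family : Prop :=
| K_g1 (lam r : R) of lam != 0 & r != 0 & bracket_relations
    (lam *: W)
    0
    0
    0
    0
    (r *: X)
| K_g2 (lam be : R) of lam != 0 & bracket_relations
    (lam *: W)
    (be *: Y)
    (- be *: X)
    0
    0
    0
| K_g3 (al be : R) of al != 0 & bracket_relations
    (- (2 * al) *: W)
    (al *: X + be *: Y)
    (- be *: X + al *: Y)
    0
    0
    (- (2 * al) *: W)
| K_g6 (z1 z3 : R) of z1 != 0 & z3 != 0 & bracket_relations
    0
    (z1 *: Z - (z1 ^+ 2 / z3) *: W)
    (((z1 ^+ 2 - z3 ^+ 2) / (2 * z3)) *: Z + z1 *: W)
    (z3 *: Z - z1 *: W)
    (z1 *: Z - ((z1 ^+ 2 - z3 ^+ 2) / (2 * z3)) *: W)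
    (((z1 ^+ 2 + z3 ^+ 2) / z3) *: X)
| K_g7 (z2 : R) of z2 != 0 & bracket_relations
    0
    (- (2 * z2) *: W)
    (z2 *: Z)
    0
    (- z2 *: W)
    ((2 * z2) *: X)
| K_g8 (w2 r : R) of r != 0 & bracket_relations
    0
    0
    (w2 *: W)
    0
    (- w2 *: Z)
    (r *: X)
| K_g9 (z2 : R) of z2 != 0 & bracket_relations
    0
    0
    (z2 *: Z)
    (- (2 * z2) *: Z)
    (- z2 *: W)
    (- (2 * z2) *: X)
| K_g12 (w1 w2 : R) of w1 != 0 & bracket_relations
    0
    (w1 *: W)
    (w2 *: W)
    (- w1 *: Z)
    (- w2 *: Z)
    0
| K_g14 (w2 : R) of bracket_relations
    0
    0
    (w2 *: W)
    0
    (- w2 *: Z)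
    0
| K_g16 (be : R) of be != 0 & bracket_relations
    0
    (be *: Y)
    (- be *: X)
    0
    0
    0
| K_g18 (be b : R) of be != 0 & b != 0 & bracket_relations
    0
    (be *: Y)
    (- be *: X)
    (b *: Y)
    (- b *: X)
    0.

End Families.

(* Main.v *)
Require Import Defs.
From HB Require Import structures.
From mathcomp Require Import all_boot all_order all_algebra reals.
From mathcomp Require Import ring lra.

(** The tangent algebra of G is studied in an orthonormal frame X, Y = J X, Z,
W = J Z with Z, W in the subalgebra k.  Such frames exist, and two of them
differ by a rotation of (X, Y) and a rotation of (Z, W).  Through the
Levi-Civita connection, conformality says that for T in k the horizontal part
of ad T restricted to the horizontal plane is a similarity, and minimality says
that for N horizontal the vertical part of ad N restricted to k has trace zero
([conformal_bracket], [minimal_bracket]).  Rotating (X, Y) makes the horizontal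
part of [Y, X] a multiple of X and rotating (Z, W) makes [W, Z] a multiple of W,
so all brackets are given by fourteen numbers ([adapted_brackets]), tied only by
the Jacobi identities ([jacobi_equations]).

Writing p = al + i be and q = a + i b for the two similarities, the rotation of
(Z, W) that remains free when k is abelian can be spent on making q = 0,
unless p and q are linearly independent over the reals.  This leaves three
cases ([reduced]), in each of which the Jacobi identities can be solved.
- If k is not abelian, say [W, Z] = lam W, then q vanishes and the solutions
  differ according to whether p = lam ([jacobi_nonabelian_leaf]).
- If p, q are independent, all remaining constants are polynomials in p, q, their
  conjugates and one real number s ([jacobi_nondegenerate]).
- If k is abelian and q = 0, either p is nonzero and almost everything vanishes
  ([jacobi_degenerate]), or p = q = 0 and the horizontal fields act on k by two
  trace-free matrices A, B whose commutator is proportional to A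
  ([jacobi_vertical_solvable], [jacobi_vertical_abelian]).

On these solutions the almost Kähler condition is two linear equations,
th1 = 2 a and th2 = - 2 al, and integrability is two linear equations among the
vertical constants; imposing them gives the lists.  In the Kähler case the frame
found for the integrable list is kept: the almost Kähler equations then fix or
exclude th1, th2 family by family. *)

Set Implicit Arguments.
Unset Strict Implicit.
Unset Printing Implicit Defensive.

Import Order.TTheory GRing.Theory Num.Theory.

Local Open Scope ring_scope.

(** * Euclidean vector spaces *)

Section EuclideanSpace.
Variables (R : realType) (V : vectType R) (g : {dot V for idfun}).
Implicit Types (u v : V) (U : {vspace V}) (e : seq V).

Lemma dotC u v : g u v = g v u.
Proof. by rewrite hermC expr0 mul1r. Qed.

Lemma dot_eq0 u : (g u u == 0) = (u == 0).
Proof.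
apply/eqP/eqP => [|->]; last exact: linear0l.
by apply: contra_eq => /(@neq0_dnorm_gt0 _ _ _ g) /lt0r_neq0.
Qed.

(** The entries of an orthonormal sequence are distinct, because equal entries
would have product 1 and 0 at once. *)
Lemma orthonormal_mem e u v : orthonormal g e -> u \in e -> v \in e ->
  g u v = (u == v)%:R.
Proof.
elim: e => //= w e IH /andP[/= /andP[/eqP ww e1] /andP[/andP[we _] oe]].
have {}IH := IH (introT andP (conj e1 oe)).
have wx x : x \in e -> g w x = 0 by move=> xe; apply/eqP/(allP we).
have wN x : x \in e -> (w == x) = false.
  move=> xe; apply/eqP => E; have /eqP := wx _ xe.
  by rewrite -E ww oner_eq0.
rewrite !inE => /orP[/eqP->|ue] /orP[/eqP->|ve].
- by rewrite ww eqxx.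
- by rewrite wx // wN.
- by rewrite dotC wx // eq_sym wN.
- exact: IH.
Qed.

Lemma orthonormal_is_free e : orthonormal g e -> free e.
Proof.
elim: e => [|w e IH] /=; first by rewrite nil_free.
move=> /andP[/= /andP[/eqP ww e1] /andP[/andP[we _] oe]].
rewrite free_cons (IH (introT andP (conj e1 oe))) // andbT.
apply/negP => wse; suff /eqP : g w w = 0 by rewrite ww oner_eq0.
have : orthogonal g [:: w] e by rewrite /orthogonal /= we.
by rewrite orthogonalE => /orthovP; apply => //; rewrite memv_span1.
Qed.

Lemma orthonormal_basis e U : {subset e <= U} -> orthonormal g e ->
  size e = \dim U -> basis_of U e.
Proof.
move=> eU oe se; rewrite basisEfree orthonormal_is_free //= se leqnn andbT.
exact/span_subvP.
Qed.

(** The difference of the two sides lies in U and is orthogonal to a basis of U,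
hence to itself. *)
Lemma orthonormal_expansion e U v : basis_of U e -> orthonormal g e ->
  v \in U -> v = \sum_(x <- e) g v x *: x.
Proof.
move=> be oe vU; apply/eqP; rewrite -subr_eq0 -dot_eq0.
set w := v - _.
have we x : x \in e -> g x w = 0.
  move=> xe; rewrite /w linearBr linear_sumr.
  have ue := free_uniq (basis_free be).
  rewrite (bigD1_seq x) //= linearZr_LR /= big1_seq => [|y /andP[yx ye]].
    by rewrite (orthonormal_mem oe xe xe) eqxx mulr1 addr0 dotC subrr.
  by rewrite linearZr_LR /= (orthonormal_mem oe xe ye) eq_sym (negbTE yx) mulr0.
have wU : w \in <<e>>%VS.
  rewrite (span_basis be) rpredB // big_seq rpred_sum // => x xe.
  by rewrite rpredZ // (basis_mem be).
suff /orthovP : (<<e>> <= orthov g <[w]>)%VS.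
  by move=> /(_ w w wU (memv_line w)) /eqP.
apply/span_subvP => x xe; rewrite mem_orthov1; exact/eqP/we.
Qed.

Lemma capv_orthov U : (U :&: orthov g U = 0)%VS.
Proof.
apply/eqP; rewrite -subv0; apply/subvP => u; rewrite memv_cap memv0 -dot_eq0.
by move=> /andP[uU /mem_orthovP /(_ u uU) ->].
Qed.

(** Each vector of the sequence cuts the dimension by at most one. *)
Lemma dim_orthov_span e U :
  (\dim U - size e <= \dim (U :&: orthov g <<e>>))%N.
Proof.
elim: e U => [|u e IH] U; first by rewrite span_nil orthov0 capvf subn0.
have := leq_dim_orthov1 g u U; rewrite -subn1 => le1.
rewrite /= -add1n subnDA.
apply: leq_trans (leq_trans (leq_sub2r (size e) le1) (IH _)) _.
apply/dimvS/subvP => v; rewrite !memv_cap span_cons -andbA.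
case/and3P => -> vu ve /=; move: vu ve.
by rewrite !memvE orthovD => -> ->.
Qed.

Lemma addv_orthov U : (U + orthov g U)%VS = fullv.
Proof.
apply/eqP; rewrite eqEdim subvf dimv_disjoint_sum ?capv_orthov //.
have := dim_orthov_span (vbasis U) fullv.
by rewrite capfv (span_basis (vbasisP U)) size_tuple leq_subLR.
Qed.

Lemma unit_vector U : U != 0%VS -> exists2 u, u \in U & g u u = 1.
Proof.
move=> U0; have uU := memv_pick U; move: U0; rewrite -vpick0.
set u := vpick U in uU * => u0; have gu := neq0_dnorm_gt0 (s := g) u u0.
exists ((Num.sqrt (g u u))^-1 *: u); first exact: rpredZ.
rewrite linearZl_LR linearZr_LR /= mulrA -expr2 exprVn sqr_sqrtr ?ltW //.
by rewrite mulVf ?gt_eqF.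
Qed.

End EuclideanSpace.

(** * Adapted frames of a foliation *)

Section AdaptedFrames.
Variables (R : realType) (V : vectType R) (g : {dot V for idfun}).
Variables (k : {vspace V}) (J : 'End(V)).
Hypotheses (dimV : \dim {:V} = 4%N) (dimk : \dim k = 2%N).
Hypotheses (herm : almost_hermitian g J) (adJ : adapted g k J).

Lemma horizontal_dot u v : u \in horizontal g k -> v \in k -> g u v = 0.
Proof. by move=> uh vk; move: v vk; apply/mem_orthovP. Qed.

(** J is both orthogonal and of square - 1, hence skew-symmetric. *)
Lemma dot_J u : g u (J u) = 0.
Proof.
case: herm => JJ gJ; have := gJ u (J u).
by rewrite JJ linearNr /= (dotC g (J u)); lra.
Qed.

(** An adapted frame is determined by its unit vectors X and Z: this is how the
frames below are produced, in particular after a rotation. *)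
Lemma adapted_basis_intro X Z : X \in horizontal g k -> Z \in k ->
  g X X = 1 -> g Z Z = 1 -> adapted_basis g k J X (J X) Z (J Z).
Proof.
case: herm adJ => JJ gJ [Jk Jh] Xh Zk XX ZZ.
have Yh : J X \in horizontal g k by rewrite -Jh memv_img.
have Wk : J Z \in k by rewrite -Jk memv_img.
have on : orthonormal g [:: X; J X; Z; J Z].
  by rewrite /orthonormal /ortho_rec /= !gJ XX ZZ !dot_J !horizontal_dot ?eqxx.
split=> //; split=> //; apply: (orthonormal_basis _ on) => // u _; exact: memvf.
Qed.

Lemma adapted_basis_gram X Y Z W : adapted_basis g k J X Y Z W ->
  (g X X = 1) * (g Y Y = 1) * (g Z Z = 1) * (g W W = 1) *
  (g X Y = 0) * (g Y X = 0) * (g X Z = 0) * (g Z X = 0) *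
  (g X W = 0) * (g W X = 0) * (g Y Z = 0) * (g Z Y = 0) *
  (g Y W = 0) * (g W Y = 0) * (g Z W = 0) * (g W Z = 0).
Proof.
case=> [[_ on] [Zk Wk] [Xh Yh] JX JZ].
move: on; rewrite /orthonormal /ortho_rec /= !andbT.
move=> /andP[/and4P[/eqP-> /eqP-> /eqP-> /eqP->]].
move=> /and3P[/and3P[/eqP XY /eqP XZ /eqP XW] /andP[/eqP YZ /eqP YW] /eqP ZW].
rewrite (dotC g Y X) (dotC g Z X) (dotC g W X) (dotC g Z Y) (dotC g W Y).
by rewrite (dotC g W Z) XY XZ XW YZ YW ZW; do !split.
Qed.

Lemma adapted_basis_expansion X Y Z W v : adapted_basis g k J X Y Z W ->
  v = g v X *: X + g v Y *: Y + g v Z *: Z + g v W *: W.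
Proof.
case=> [[ba on] _ _ _ _].
by rewrite {1}(orthonormal_expansion ba on (memvf v)) !big_cons big_nil addr0 !addrA.
Qed.

Lemma adapted_basis_k X Y Z W : adapted_basis g k J X Y Z W ->
  basis_of k [:: Z; W] /\ orthonormal g [:: Z; W].
Proof.
case=> [[_ on] [Zk Wk] _ _ _].
have {}on : orthonormal g [:: Z; W].
  by move: on; rewrite /orthonormal /= => /andP[/and4P[_ _ -> ->]] /and3P[_ _ ->].
split=> //; apply: (orthonormal_basis _ on) => // u.
by rewrite !inE => /orP[/eqP->|/eqP->].
Qed.

Lemma adapted_basis_exists : exists X Y Z W, adapted_basis g k J X Y Z W.
Proof.
have [Z Zk ZZ] : exists2 Z, Z \in k & g Z Z = 1.
  by apply: unit_vector; rewrite -dimv_eq0 dimk.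
have [X Xh XX] : exists2 X, X \in horizontal g k & g X X = 1.
  apply: unit_vector; rewrite -dimv_eq0.
  have := dimv_disjoint_sum (capv_orthov g k).
  by rewrite addv_orthov dimV dimk /horizontal; case: (\dim _).
by exists X, (J X), Z, (J Z); apply: adapted_basis_intro.
Qed.

Lemma adapted_basis_rot_horizontal X Y Z W c s : c ^+ 2 + s ^+ 2 = 1 ->
  adapted_basis g k J X Y Z W ->
  adapted_basis g k J (c *: X + s *: Y) (- s *: X + c *: Y) Z W.
Proof.
move=> cs ab; have G := adapted_basis_gram ab.
case: ab => [_ [Zk Wk] [Xh Yh] JX JZ]; case: (herm) => JJ gJ.
have -> : - s *: X + c *: Y = J (c *: X + s *: Y).
  by rewrite linearD !linearZ /= -JX JJ scalerN scaleNr addrC.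
rewrite -JZ; apply: adapted_basis_intro; rewrite ?rpredD ?rpredZ ?G //.
rewrite !(linearDr, linearDl, linearZr_LR, linearZl_LR) /= !G; lra.
Qed.

Lemma adapted_basis_rot_vertical X Y Z W c s : c ^+ 2 + s ^+ 2 = 1 ->
  adapted_basis g k J X Y Z W ->
  adapted_basis g k J X Y (c *: Z + s *: W) (- s *: Z + c *: W).
Proof.
move=> cs ab; have G := adapted_basis_gram ab.
case: ab => [_ [Zk Wk] [Xh Yh] JX JZ]; case: (herm) => JJ gJ.
have -> : - s *: Z + c *: W = J (c *: Z + s *: W).
  by rewrite linearD !linearZ /= -JZ JJ scalerN scaleNr addrC.
rewrite -JX; apply: adapted_basis_intro; rewrite ?rpredD ?rpredZ ?G //.
rewrite !(linearDr, linearDl, linearZr_LR, linearZl_LR) /= !G; lra.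
Qed.

End AdaptedFrames.

(** * Brackets along a conformal foliation with minimal leaves *)

Section FoliationBrackets.
Variables (R : realType) (V : vectType R) (br : {bilinear V -> V -> V}).
Variables (g : {dot V for idfun}) (nabla : {bilinear V -> V -> V}).
Variables (k : {vspace V}) (J : 'End(V)).
Hypotheses (dimk : \dim k = 2%N).
Hypotheses (lie : lie_bracket br) (lc : levi_civita br g nabla).

Lemma brC u v : br u v = - br v u.
Proof.
case: lie => alt _; have := alt (u + v).
rewrite linearDl !linearDr /= !alt add0r addr0 => /eqP.
by rewrite addr_eq0 => /eqP.
Qed.

Lemma vproj_dot v w : w \in k -> g (vproj g k v) w = g v w.
Proof.
move=> wk; have vin : v \in (k + horizontal g k)%VS by rewrite addv_orthov memvf.
rewrite -{2}(daddv_pi_add (capv_orthov g k) vin) linearDl /=.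
by rewrite [X in _ + X](@horizontal_dot _ _ g k) ?memv_pi // addr0.
Qed.

Lemma hproj_dot v w : w \in horizontal g k -> g (hproj g k v) w = g v w.
Proof.
move=> wh; have vin : v \in (horizontal g k + k)%VS.
  by rewrite addvC addv_orthov memvf.
have cap : (horizontal g k :&: k = 0)%VS by rewrite capvC capv_orthov.
rewrite -{2}(daddv_pi_add cap vin) linearDl /=.
by rewrite [X in _ + X]dotC [X in _ + X](@horizontal_dot _ _ g k) ?memv_pi // addr0.
Qed.

Lemma nablaC u v : nabla u v = nabla v u + br u v.
Proof. by case: lc => /(_ u v) <- _; rewrite addrC subrK. Qed.

Lemma dot_nabla u v w : g (nabla u v) w = - g v (nabla u w).
Proof. by case: lc => _ /(_ u v w) /eqP; rewrite addr_eq0 => /eqP. Qed.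

Lemma dot_nabla_same u v : g v (nabla u v) = 0.
Proof. by have := dot_nabla u v v; rewrite dotC; lra. Qed.

(** Since nabla is metric and torsion-free, both sides are 2 g(B_H(E, F), T), the
left one being also minus the Lie derivative of g along T.  The symmetric part
of ad T on the horizontal plane is therefore a multiple of the identity. *)
Lemma conformal_bracket : conformal_foliation g nabla k ->
  exists U, forall T E F, T \in k -> E \in horizontal g k ->
    F \in horizontal g k ->
    g (br T E) F + g (br T F) E = 2 * g U T * g E F.
Proof.
case=> U Uk BU; exists U => T E F Tk Eh Fh.
have := congr1 (fun x => g x T) (BU E F Eh Fh).
rewrite /B_H !linearZl_LR /= vproj_dot // linearDl /= !dot_nabla.
rewrite (nablaC E T) (nablaC F T) !linearDr /=.
have := dot_nabla T E F.
rewrite (brC E) (brC F) !linearNr /= !(dotC g E) !(dotC g F).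
move=> H1 H2.
have -> : 2 * g U T * g E F = 2 * (g E F * g U T) by ring.
by rewrite -H2; lra.
Qed.

(** The left side is the negative of the trace of B_V paired with N, as
g(nabla_N Z, Z) = 0. *)
Lemma minimal_bracket : minimal_leaves g nabla k ->
  forall X Y Z W N, adapted_basis g k J X Y Z W -> N \in horizontal g k ->
    g (br Z N) Z + g (br W N) W = 0.
Proof.
move=> mini X Y Z W N ab Nh; have [ba on] := adapted_basis_k dimk ab.
have := congr1 (fun x => g x N) (mini _ ba on).
rewrite !big_cons big_nil addr0 linearDl linear0l /B_V !linearZl_LR /=.
rewrite !hproj_dot // !linearDl /= !dot_nabla (nablaC Z N) (nablaC W N).
rewrite !linearDr /= !dot_nabla_same (dotC g (br Z N)) (dotC g (br W N)).
lra.
Qed.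

End FoliationBrackets.

(** * Structure constants *)

Section StructureConstants.
Variables (R : realType) (V : vectType R) (br : V -> V -> V) (X Y Z W : V).
Variables (lam al be a b z1 z2 z3 z4 w1 w2 r th1 th2 : R).

(** The shape of the brackets in a well-rotated frame.  With the horizontal plane
read as the complex line in which Y = i X, the fields Z and W act on it by
multiplication by al + i be and a + i b; the signs of the coefficients of W in
[W, X] and [W, Y] express that X and Y act on k without trace. *)
Definition adapted_brackets : Prop := bracket_relations br X Y Z W
  (lam *: W)
  (al *: X + be *: Y + z1 *: Z + w1 *: W)
  (- be *: X + al *: Y + z2 *: Z + w2 *: W)
  (a *: X + b *: Y + z3 *: Z - z1 *: W)
  (- b *: X + a *: Y + z4 *: Z - z2 *: W)
  (r *: X + th1 *: Z + th2 *: W).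

End StructureConstants.

(** The field named ABC_D is the component along D of the Jacobi identity for
A, B, C. *)
Record jacobi_equations (R : comNzRingType)
    (lam al be a b z1 z2 z3 z4 w1 w2 r th1 th2 : R) : Prop := JacobiEquations {
  ZWX_X : lam * a = 0;
  ZWX_Y : lam * b = 0;
  ZWX_Z : a * z1 + b * z2 - al * z3 - be * z4 = - lam * z3;
  ZWX_W : a * w1 + b * w2 + al * z1 + be * z2 = lam * z1;
  ZWY_Z : a * z2 - b * z1 + be * z3 - al * z4 = - lam * z4;
  ZWY_W : a * w2 - b * w1 - be * z1 + al * z2 = lam * z2;
  ZXY_X : be * z1 + al * z2 + b * w1 + a * w2 = - (r * al);
  ZXY_Y : be * z2 - al * z1 + b * w2 - a * w1 = r * be;
  ZXY_Z : r * z1 = 2 * al * th1 + (w2 * z3 - w1 * z4);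
  ZXY_W : r * w1 - lam * th2 = 2 * al * th2 + 2 * (z2 * w1 - z1 * w2);
  WXY_X : be * z3 + al * z4 - b * z1 - a * z2 = - (r * a);
  WXY_Y : be * z4 - al * z3 - b * z2 + a * z1 = r * b;
  WXY_Z : r * z3 = 2 * a * th1 + 2 * (z1 * z4 - z2 * z3);
  WXY_W : lam * th1 - r * z1 = 2 * a * th2 + (w1 * z4 - w2 * z3)
}.

(** What the rotations can achieve on the brackets of Z, W with each other and
with X: p = al + i be and q = a + i b are independent, or q = 0, or k is not
abelian, in which case the Jacobi identities will force q = 0. *)
Definition reduced (R : comNzRingType) (lam al be a b : R) : Prop :=
  [\/ lam != 0, lam = 0 /\ al * b - a * be != 0
    | [/\ lam = 0, a = 0 & b = 0]].

Lemma polar_form (R : rcfType) (m n : R) :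
  exists c s t, [/\ c ^+ 2 + s ^+ 2 = 1, m = t * c & n = t * s].
Proof.
have [/andP[/eqP-> /eqP->]|mn] := boolP ((m == 0) && (n == 0)).
  by exists 1, 0, 0; split; ring.
have N0 : 0 < m ^+ 2 + n ^+ 2.
  rewrite lt_neqAle addr_ge0 ?sqr_ge0 // andbT eq_sym.
  by rewrite paddr_eq0 ?sqr_ge0 // !sqrf_eq0.
have t0 : Num.sqrt (m ^+ 2 + n ^+ 2) != 0 by rewrite gt_eqF ?sqrtr_gt0.
have t2 := sqr_sqrtr (ltW N0); move: t0 t2; set t := Num.sqrt _ => t0 t2.
exists (m / t), (n / t), t; split.
- by rewrite !expr_div_n -mulrDl -t2 divff ?expf_neq0.
- by field.
- by field.
Qed.

Section NormalForm.
Variables (R : realType) (V : vectType R) (br : {bilinear V -> V -> V}).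
Variables (g : {dot V for idfun}) (nabla : {bilinear V -> V -> V}).
Variables (k : {vspace V}) (J : 'End(V)).
Hypotheses (dimV : \dim {:V} = 4%N) (dimk : \dim k = 2%N).
Hypotheses (herm : almost_hermitian g J) (adJ : adapted g k J).
Hypotheses (lie : lie_bracket br) (lc : levi_civita br g nabla).
Hypotheses (subk : subalgebra br k).
Hypotheses (conf : conformal_foliation g nabla k).
Hypotheses (mini : minimal_leaves g nabla k).

(** The bracket of the two vectors of a plane is an area form. *)
Lemma br_rot X Y c s : c ^+ 2 + s ^+ 2 = 1 ->
  br (- s *: X + c *: Y) (c *: X + s *: Y) = br Y X.
Proof.
move=> cs; case: (lie) => alt _.
rewrite !(linearDr, linearDl, linearZr_LR, linearZl_LR) /= !alt.
rewrite (brC lie X Y) !(scaler0, add0r, addr0, scalerN, scaleNr, opprK).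
by rewrite !scalerA -scalerDl -!expr2 cs scale1r.
Qed.

(** The rotations are chosen one after the other, which is possible because
[W, Z] and [Y, X] do not change under a rotation of the plane in question. *)
Lemma normal_frame : exists X Y Z W, [/\ adapted_basis g k J X Y Z W,
   g (br Y X) Y = 0, g (br W Z) Z = 0 &
   reduced (g (br W Z) W) (g (br Z X) X) (g (br Z X) Y)
     (g (br W X) X) (g (br W X) Y)].
Proof.
have [X0 [Y0 [Z0 [W0 ab0]]]] := adapted_basis_exists dimV dimk herm adJ.
(* Align X with the horizontal part of [Y, X]. *)
have [c [s [t [cs mE nE]]]] := polar_form (g (br Y0 X0) X0) (g (br Y0 X0) Y0).
have {ab0} := adapted_basis_rot_horizontal dimV herm adJ cs ab0.
have : g (br (- s *: X0 + c *: Y0) (c *: X0 + s *: Y0)) (- s *: X0 + c *: Y0) = 0.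
  rewrite br_rot // linearDr !linearZr_LR /= mE nE; ring.
set X := c *: X0 + _; set Y := _ + c *: Y0; move: X Y => X Y YX ab0.
(* Align W with [W, Z]. *)
have {c s t cs mE nE} [c [s [t [cs mE nE]]]] :=
  polar_form (g (br W0 Z0) W0) (- g (br W0 Z0) Z0).
have {ab0} := adapted_basis_rot_vertical dimV herm adJ cs ab0.
have : g (br (- s *: Z0 + c *: W0) (c *: Z0 + s *: W0)) (c *: Z0 + s *: W0) = 0.
  rewrite br_rot // linearDr !linearZr_LR /= mE.
  by rewrite -[g _ Z0]opprK nE; ring.
set Z := c *: Z0 + _; set W := _ + c *: W0; move: Z W => Z W WZ ab.
have [lam0|lam0] := eqVneq (g (br W Z) W) 0; last first.
  by exists X, Y, Z, W; split=> //; constructor 1.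
have [D0|D0] := eqVneq (g (br Z X) X * g (br W X) Y -
         g (br W X) X * g (br Z X) Y) 0; last first.
  by exists X, Y, Z, W; split=> //; constructor 2.
clear c s t cs mE nE.
(* When p and q are real multiples of a common complex number, a rotation of
   (Z, W) kills q; its angle is read off the real parts of p and q, or off the
   imaginary parts when the real parts vanish. *)
have [c [s [cs e1 e2]]] : exists c s, [/\ c ^+ 2 + s ^+ 2 = 1,
   c * g (br W X) X = s * g (br Z X) X & c * g (br W X) Y = s * g (br Z X) Y].
  have [c [s [t [cs E1 E2]]]] := polar_form (g (br Z X) X) (g (br W X) X).
  have [t0|t0] := eqVneq t 0; last first.
    exists c, s; split=> //; first by rewrite E1 E2; ring.
    apply: (mulfI t0); move: D0; rewrite E1 E2; lra.
  have [c' [s' [t' [cs' E1' E2']]]] := polar_form (g (br Z X) Y) (g (br W X) Y).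
  by exists c', s'; split=> //; rewrite ?E1 ?E2 ?E1' ?E2' ?t0; ring.
exists X, Y, (c *: Z + s *: W), (- s *: Z + c *: W).
have WZk : br W Z = 0.
  case: (ab) => [_ [Zk Wk] _ _ _].
  have [ba on] := adapted_basis_k dimk ab.
  rewrite (orthonormal_expansion ba on (subk Wk Zk)) !big_cons big_nil.
  by rewrite WZ lam0 !scale0r !addr0.
split=> //; first exact: (adapted_basis_rot_vertical dimV herm adJ).
  by rewrite br_rot // WZk linear0l.
constructor 3; split; first by rewrite br_rot // WZk linear0l.
  rewrite !(linearDl, linearZl_LR) /=; lra.
rewrite !(linearDl, linearZl_LR) /=; lra.
Qed.

Lemma adapted_brackets_exist : exists X Y Z W,
  exists lam al be a b z1 z2 z3 z4 w1 w2 r th1 th2,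
  [/\ adapted_basis g k J X Y Z W,
      adapted_brackets br X Y Z W lam al be a b z1 z2 z3 z4 w1 w2 r th1 th2 &
      reduced lam al be a b].
Proof.
have [X [Y [Z [W [ab YX WZ tri]]]]] := normal_frame.
exists X, Y, Z, W.
exists (g (br W Z) W), (g (br Z X) X), (g (br Z X) Y), (g (br W X) X),
  (g (br W X) Y), (g (br Z X) Z), (g (br Z Y) Z), (g (br W X) Z),
  (g (br W Y) Z), (g (br Z X) W), (g (br Z Y) W), (g (br Y X) X),
  (g (br Y X) Z), (g (br Y X) W).
split=> //.
have G := adapted_basis_gram ab.
case: (ab) => [_ [Zk Wk] [Xh Yh] _ _].
have [U BU] := conformal_bracket lie lc conf.
have ex v := adapted_basis_expansion v ab.
have cZ := BU Z _ _ Zk; have cW := BU W _ _ Wk.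
have cZX := cZ _ _ Xh Xh; have cZY := cZ _ _ Yh Yh; have cZXY := cZ _ _ Xh Yh.
have cWX := cW _ _ Xh Xh; have cWY := cW _ _ Yh Yh; have cWXY := cW _ _ Xh Yh.
have mX := minimal_bracket dimk lc mini ab Xh.
have mY := minimal_bracket dimk lc mini ab Yh.
move: cZX cZY cZXY cWX cWY cWXY; rewrite !G => cZX cZY cZXY cWX cWY cWXY.
have eWZ : br W Z = g (br W Z) W *: W.
  case: (adapted_basis_k dimk ab) => ba on.
  rewrite {1}(orthonormal_expansion ba on (subk Wk Zk)) !big_cons big_nil.
  by rewrite WZ scale0r add0r addr0.
have eZX := ex (br Z X).
have eZY : br Z Y = - g (br Z X) Y *: X + g (br Z X) X *: Y + g (br Z Y) Z *: Z +
    g (br Z Y) W *: W.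
  by rewrite {1}[br Z Y]ex; congr (_ *: _ + _ *: _ + _ + _); lra.
have eWX : br W X = g (br W X) X *: X + g (br W X) Y *: Y + g (br W X) Z *: Z -
    g (br Z X) Z *: W.
  rewrite {1}[br W X]ex -scaleNr; congr (_ + _ + _ + _ *: _); lra.
have eWY : br W Y = - g (br W X) Y *: X + g (br W X) X *: Y + g (br W Y) Z *: Z -
    g (br Z Y) Z *: W.
  rewrite {1}[br W Y]ex -scaleNr; congr (_ *: _ + _ *: _ + _ + _ *: _); lra.
have eYX : br Y X = g (br Y X) X *: X + g (br Y X) Z *: Z + g (br Y X) W *: W.
  by rewrite {1}[br Y X]ex YX scale0r addr0.
by split.
Qed.

Lemma adapted_basis_coords X Y Z W v x y z w : adapted_basis g k J X Y Z W ->
  v = x *: X + y *: Y + z *: Z + w *: W ->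
  (g v X = x) * (g v Y = y) * (g v Z = z) * (g v W = w).
Proof.
move=> ab ->; have G := adapted_basis_gram ab.
by do !split; rewrite !linearDl !linearZl_LR /= !G; ring.
Qed.

Lemma dot_br_expansion X Y Z W u v t : adapted_basis g k J X Y Z W ->
  g (br u v) t = g v X * g (br u X) t + g v Y * g (br u Y) t +
    g v Z * g (br u Z) t + g v W * g (br u W) t.
Proof.
move=> ab; rewrite {1}(adapted_basis_expansion v ab).
by rewrite !linearDr !linearZr_LR /= !linearDl !linearZl_LR.
Qed.

Lemma adapted_brackets_coords X Y Z W
    lam al be a b z1 z2 z3 z4 w1 w2 r th1 th2 (c := fun v x y z w =>
      ((g v X = x) * (g v Y = y) * (g v Z = z) * (g v W = w))%type) :
  adapted_basis g k J X Y Z W ->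
  adapted_brackets br X Y Z W lam al be a b z1 z2 z3 z4 w1 w2 r th1 th2 ->
  c (br W Z) 0 0 0 lam * c (br Z X) al be z1 w1 * c (br Z Y) (- be) al z2 w2 *
  c (br W X) a b z3 (- z1) * c (br W Y) (- b) a z4 (- z2) *
  c (br Y X) r 0 th1 th2.
Proof.
move=> ab [[WZ ZX] [[ZY WX] [WY YX]]].
by split; [split; [split; [split; [split|]|]|]|];
  apply: (adapted_basis_coords ab);
  rewrite ?WZ ?ZX ?ZY ?WX ?WY ?YX ?scale0r ?add0r ?addr0 ?scaleNr.
Qed.

(** Since the frame is orthonormal, the inner bracket of each Jacobi identity can
be expanded along the frame, which leaves products of structure constants. *)
Lemma jacobi_of_brackets X Y Z W lam al be a b z1 z2 z3 z4 w1 w2 r th1 th2 :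
  adapted_basis g k J X Y Z W ->
  adapted_brackets br X Y Z W lam al be a b z1 z2 z3 z4 w1 w2 r th1 th2 ->
  jacobi_equations lam al be a b z1 z2 z3 z4 w1 w2 r th1 th2.
Proof.
move=> ab /(adapted_brackets_coords ab).
move=> [[[[[WZ ZX] ZY] WX] WY] YX]; case: (lie) => alt jac.
have alt0 u t : g (br u u) t = 0 by rewrite alt linear0l.
have skew u v t : g (br u v) t = - g (br v u) t.
  by rewrite (brC lie u v) linearNl.
have E := (skew X Z, skew Y Z, skew Z W, skew X W, skew Y W, skew X Y).
have {}jac u v w t :
    g (br u (br v w)) t + g (br v (br w u)) t + g (br w (br u v)) t = 0.
  by rewrite -!linearDl /= jac linear0l.
have ex u v t := dot_br_expansion u v t ab.
split; [have := jac Z W X X|have := jac Z W X Y|have := jac Z W X Z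
 |have := jac Z W X W|have := jac Z W Y Z|have := jac Z W Y W
 |have := jac Z X Y X|have := jac Z X Y Y|have := jac Z X Y Z
 |have := jac Z X Y W|have := jac W X Y X|have := jac W X Y Y
 |have := jac W X Y Z|have := jac W X Y W]; rewrite !(ex _ (br _ _)).
all: rewrite !alt0.
all: rewrite !E.
all: rewrite ?WZ ?ZX ?ZY ?WX ?WY ?YX.
all: lra.
Qed.

End NormalForm.

(** * Almost Kähler and integrable structures in an adapted frame *)

Section Hermitian.
Variables (R : realType) (V : vectType R) (br : {bilinear V -> V -> V}).
Variables (g : {dot V for idfun}) (k : {vspace V}) (J : 'End(V)).
Hypotheses (herm : almost_hermitian g J) (lie : lie_bracket br).
Variables (X Y Z W : V).
Hypothesis ab : adapted_basis g k J X Y Z W.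

Lemma dot_Jl u v : g (J u) v = - g u (J v).
Proof.
by case: herm => JJ gJ; have := gJ u (J v); rewrite JJ linearNr /=; lra.
Qed.

Lemma J_adapted_basis : (J X = Y) * (J Y = - X) * (J Z = W) * (J W = - Z).
Proof. by case: ab herm => _ _ _ <- <- [JJ _]; rewrite !JJ. Qed.

(** This is what the vanishing of d omega on (X, Y, Z) and on (X, Y, W) means. *)
Lemma almost_kahler_bracket : almost_kahler br g J ->
  g (br Y X) W = - g (br Z X) X - g (br Z Y) Y /\
  g (br Y X) Z = g (br W X) X + g (br W Y) Y.
Proof.
move=> ak; have akZ := ak X Y Z; have akW := ak X Y W.
rewrite /ext_deriv /kahler_form !dot_Jl !J_adapted_basis in akZ akW.
rewrite !(brC lie X) !(brC lie Y Z) !(brC lie Y W) in akZ akW.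
rewrite !linearNr /= !linearNl /= in akZ akW.
by split; lra.
Qed.

(** This is what the vanishing of the components of N(Z, X) along Z and W means. *)
Lemma integrable_bracket : integrable br J ->
  g (br Z X) Z = g (br W X) W + g (br Z Y) W + g (br W Y) Z /\
  g (br W Y) W = g (br Z X) W + g (br W X) Z + g (br Z Y) Z.
Proof.
move=> /(_ Z X); rewrite /nijenhuis !J_adapted_basis => N.
have NZ := congr1 (fun x => g x Z) N; have NW := congr1 (fun x => g x W) N.
have gN u v : g (- u) v = - g u v by rewrite linearNl.
have gNr u v : g u (- v) = - g u v by rewrite linearNr.
rewrite /= !linearDl !linear0l /= !gN !dot_Jl !J_adapted_basis ?gNr in NZ NW.
by split; lra.
Qed.

End Hermitian.

(** * Solutions of the Jacobi identities *)

Section JacobiSolutions.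
Variables (R : realFieldType).

(** The matrix with rows (m, n), (n, - m) has determinant - (m^2 + n^2). *)
Lemma conformal_kernel (m n x y : R) : m ^+ 2 + n ^+ 2 != 0 ->
  m * x + n * y = 0 -> n * x - m * y = 0 -> x = 0 /\ y = 0.
Proof.
move=> mn e1 e2; split; apply: (mulfI mn); rewrite mulr0.
  have -> : (m ^+ 2 + n ^+ 2) * x = m * (m * x + n * y) + n * (n * x - m * y).
    by ring.
  by rewrite e1 e2; ring.
have -> : (m ^+ 2 + n ^+ 2) * y = n * (m * x + n * y) - m * (n * x - m * y).
  by ring.
by rewrite e1 e2; ring.
Qed.

Lemma sum_sqr_eq0 (m n : R) : m ^+ 2 + n ^+ 2 = 0 -> m = 0 /\ n = 0.
Proof.
move=> /eqP; rewrite paddr_eq0 ?sqr_ge0 // !sqrf_eq0.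
by case/andP => /eqP-> /eqP->.
Qed.

(** The identities for Z, W, X and Z, W, Y say that the conjugate of p - lam, with
p = al + i be, annihilates z1 + i z2 and z3 + i z4; hence the two alternatives
p <> lam and p = lam. *)
Lemma jacobi_nonabelian_leaf (lam al be a b z1 z2 z3 z4 w1 w2 r th1 th2 : R) :
  jacobi_equations lam al be a b z1 z2 z3 z4 w1 w2 r th1 th2 -> lam != 0 ->
  [/\ a = 0, b = 0 & th1 = 0] /\ [/\ z1 = 0, z3 = 0 & z4 = 0] /\
  ([/\ (lam - al) ^+ 2 + be ^+ 2 != 0, z2 = 0, r * al = 0, r * be = 0
     & r * w1 - lam * th2 = 2 * al * th2]
   \/ [/\ al = lam, be = 0, r = - z2 & 3 * (lam * th2 + z2 * w1) = 0]).
Proof.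
case=> la lb e2 e3 e4 e5 e6 e7 e8 e9 e10 e11 e12 e13 lam0.
have a0 : a = 0 by apply: (mulfI lam0); rewrite la mulr0.
have b0 : b = 0 by apply: (mulfI lam0); rewrite lb mulr0.
subst a b; have [D0|D0] := eqVneq ((lam - al) ^+ 2 + be ^+ 2) 0.
  have [E1 be0] := sum_sqr_eq0 D0; have {}E1 : al = lam by lra.
  subst al be.
  have z30 : z3 = 0 by apply: (mulfI lam0); lra.
  have z40 : z4 = 0 by apply: (mulfI lam0); lra.
  have z10 : z1 = 0 by apply: (mulfI lam0); lra.
  have rz2 : r = - z2 by apply: (mulfI lam0); lra.
  subst z1 z3 z4 r.
  have th10 : th1 = 0 by apply: (mulfI lam0); lra.
  by do !split=> //; right; split=> //; lra.
have D1 : (lam - al) ^+ 2 + (- be) ^+ 2 != 0 by rewrite sqrrN.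
have [z30 z40] : z3 = 0 /\ z4 = 0 by apply: (conformal_kernel D1); lra.
have [z10 z20] : z1 = 0 /\ z2 = 0 by apply: (conformal_kernel D1); lra.
subst z1 z2 z3 z4.
have th10 : th1 = 0 by apply: (mulfI lam0); lra.
by do !split=> //; left; split=> //; lra.
Qed.

(** Put p = al + i be, q = a + i b, u = z1 + i z2, t = z3 + i z4, v = w1 + i w2 and
write x' for the conjugate of x.  The eight linear identities read q' u = p' t, q' v = - p' u,
p u + q v = - i r p' and p t - q u = - i r q'; as p q' - p' q = - 2 i D, they
give 2 D u = r p' q', 2 D t = r q'^2 and 2 D v = - r p'^2.  The quadratic
identities then determine al th1, a th1, al th2, a th2, hence th1 and th2. *)
Lemma jacobi_nondegenerate (al be a b z1 z2 z3 z4 w1 w2 r th1 th2 : R)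
  (D := al * b - a * be) :
  jacobi_equations 0 al be a b z1 z2 z3 z4 w1 w2 r th1 th2 -> D != 0 ->
  exists s, [/\ r = 2 * D * s, th1 = 2 * D * s ^+ 2 * a,
                th2 = - (2 * D * s ^+ 2 * al)
    & [/\ z1 = s * (al * a - be * b), z2 = - (s * (al * b + be * a)) &
      [/\ z3 = s * (a ^+ 2 - b ^+ 2), z4 = - (s * (2 * a * b)),
          w1 = - (s * (al ^+ 2 - be ^+ 2)) & w2 = s * (2 * al * be)]]].
Proof.
case=> _ _ e2 e3 e4 e5 e6 e7 e8 e9 e10 e11 e12 e13 D0.
have DE : D = al * b - a * be by [].
have D20 : 2 * D != 0 by rewrite mulf_neq0 ?pnatr_eq0.
have M (c x y : R) : x = y -> c * x = c * y by move->.
exists (r / (2 * D)).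
set s := r / (2 * D); have rE : r = 2 * D * s by rewrite /s; field.
(* The combinations of the linear identities used here are the real and imaginary
   parts of their complex forms multiplied by p, q or a conjugate. *)
have Dz1 : 2 * D * z1 = r * (al * a - be * b).
  move: (M a _ _ e6) (M b _ _ e7) (M a _ _ e5) (M b _ _ e3); rewrite DE; lra.
have Dz2 : 2 * D * z2 = - r * (al * b + be * a).
  move: (M a _ _ e7) (M b _ _ e6) (M a _ _ e3) (M b _ _ e5); rewrite DE; lra.
have Dz3 : 2 * D * z3 = r * (a ^+ 2 - b ^+ 2).
  move: (M a _ _ e10) (M b _ _ e11) (M a _ _ e2) (M b _ _ e2)
        (M a _ _ e4) (M b _ _ e4); rewrite DE; lra.
have Dz4 : 2 * D * z4 = - r * (2 * a * b).
  move: (M a _ _ e11) (M b _ _ e10) (M a _ _ e2) (M b _ _ e2)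
        (M a _ _ e4) (M b _ _ e4); rewrite DE; lra.
have Dw1 : 2 * D * w1 = - r * (al ^+ 2 - be ^+ 2).
  move: (M al _ _ e6) (M be _ _ e7) (M al _ _ e3) (M be _ _ e3)
        (M al _ _ e5) (M be _ _ e5); rewrite DE; lra.
have Dw2 : 2 * D * w2 = r * (2 * al * be).
  move: (M al _ _ e7) (M be _ _ e6) (M al _ _ e3) (M be _ _ e3)
        (M al _ _ e5) (M be _ _ e5); rewrite DE; lra.
have cancelD x c : 2 * D * x = r * c -> x = s * c.
  by move=> E; apply: (mulfI D20); rewrite E rE; ring.
have E1 : z1 = s * (al * a - be * b) by apply: cancelD; rewrite Dz1.
have E2 : z2 = - (s * (al * b + be * a)).
  by rewrite -mulrN; apply: cancelD; rewrite Dz2; ring.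
have E3 : z3 = s * (a ^+ 2 - b ^+ 2) by apply: cancelD; rewrite Dz3.
have E4 : z4 = - (s * (2 * a * b)).
  by rewrite -mulrN; apply: cancelD; rewrite Dz4; ring.
have E5 : w1 = - (s * (al ^+ 2 - be ^+ 2)).
  by rewrite -mulrN; apply: cancelD; rewrite Dw1; ring.
have E6 : w2 = s * (2 * al * be) by apply: cancelD; rewrite Dw2.
rewrite rE E1 E2 E3 E4 E5 E6 DE in e8 e9 e12 e13.
have cancel2 x : al * x = 0 -> a * x = 0 -> x = 0.
  move=> alx ax; apply: (mulfI D0); rewrite mulr0 DE.
  have -> : (al * b - a * be) * x = b * (al * x) - be * (a * x) by ring.
  by rewrite alx ax; ring.
have E7 : th1 = 2 * D * s ^+ 2 * a.
  by apply/eqP; rewrite -subr_eq0; apply/eqP/cancel2; rewrite DE; lra.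
have E8 : th2 = - (2 * D * s ^+ 2 * al).
  by apply/eqP; rewrite -subr_eq0; apply/eqP/cancel2; rewrite DE; lra.
by do !split.
Qed.

(** With q = 0 the linear identities read p' u = p' t = 0 and p u = - i r p',
in the notation of [jacobi_nondegenerate]. *)
Lemma jacobi_degenerate (al be z1 z2 z3 z4 w1 w2 r th1 th2 : R) :
  jacobi_equations 0 al be 0 0 z1 z2 z3 z4 w1 w2 r th1 th2 ->
  al ^+ 2 + be ^+ 2 != 0 ->
  [/\ z1 = 0, z2 = 0, z3 = 0, z4 = 0 & [/\ r = 0, al * th1 = 0 & al * th2 = 0]].
Proof.
case=> _ _ e2 e3 e4 e5 e6 e7 e8 e9 e10 e11 e12 e13 p0.
have [z30 z40] : z3 = 0 /\ z4 = 0 by apply: (conformal_kernel p0); lra.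
have [z10 z20] : z1 = 0 /\ z2 = 0 by apply: (conformal_kernel p0); lra.
subst z1 z2 z3 z4.
have r0 : r = 0.
  have M (c x y : R) : x = y -> c * x = c * y by move->.
  apply: (mulfI p0); move: (M al _ _ e6) (M be _ _ e7); lra.
by subst r; do !split; lra.
Qed.

(** The hypotheses say that r A is, up to sign, the commutator of the trace-free
matrices A, B by which X and Y act on k.  Hence A is nilpotent, which is the
equation z1^2 + w1 z3 = 0 behind the case distinction. *)
Lemma jacobi_vertical_solvable (z1 z2 z3 z4 w1 w2 r : R) :
  r * z1 = w2 * z3 - w1 * z4 -> r * w1 = 2 * (z2 * w1 - z1 * w2) ->
  r * z3 = 2 * (z1 * z4 - z2 * z3) -> r != 0 ->
  [\/ [/\ z1 != 0, z3 != 0, w1 = - (z1 ^+ 2 / z3),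
          w2 = z1 * (r - 2 * z2) / (2 * z3) &
          z4 = z3 * (r + 2 * z2) / (2 * z1)],
      [/\ z1 = 0, z3 = 0, w1 != 0, z4 = 0 & r = 2 * z2],
      [/\ z1 = 0, w1 = 0, z3 != 0, w2 = 0 & r = - (2 * z2)]
    | [/\ z1 = 0, w1 = 0 & z3 = 0]].
Proof.
move=> e1 e2 e3 r0; have nil : z1 ^+ 2 + w1 * z3 = 0.
  have M (c x y : R) : x = y -> c * x = c * y by move->.
  apply: (mulfI r0); move: (M z1 _ _ e1) (M z3 _ _ e2) (M w1 _ _ e3); lra.
have [z10|z10] := eqVneq z1 0.
  subst z1; have /eqP : w1 * z3 = 0 by lra.
  rewrite mulf_eq0; have [w10 _|w10 /= /eqP z30] := eqVneq w1 0.
    subst w1; have [z30|z30] := eqVneq z3 0; first by constructor 4.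
    constructor 3; split=> //; apply: (mulfI z30); lra.
  subst z3; constructor 2; split=> //; apply: (mulfI w10); lra.
have z30 : z3 != 0.
  by apply: contra_neq z10 => z30; subst z3; apply/eqP; rewrite -sqrf_eq0; apply/eqP; lra.
have w1E : w1 = - (z1 ^+ 2 / z3).
  apply: (mulIf z30); rewrite mulNr divfK //; lra.
constructor 1; split=> //.
  have e2' : z1 * (2 * z3 * w2) = z1 * (z1 * (r - 2 * z2)).
    have -> : z1 * (2 * z3 * w2) = z3 * (2 * (z1 * w2)) by ring.
    have -> : 2 * (z1 * w2) = - (r - 2 * z2) * w1 by lra.
    by rewrite w1E; field.
  have {}e2' := mulfI z10 e2'.
  by rewrite -e2'; field.
have -> : z3 * (r + 2 * z2) = 2 * z1 * z4 by lra.
by field.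
Qed.

(** The matrices A, B of [jacobi_vertical_solvable] now commute, so they are
linearly dependent; the cases are given by the first nonzero entry of A. *)
Lemma jacobi_vertical_abelian (z1 z2 z3 z4 w1 w2 : R) :
  0 = w2 * z3 - w1 * z4 -> 0 = z2 * w1 - z1 * w2 ->
  0 = z1 * z4 - z2 * z3 ->
  [\/ [/\ z1 != 0, w2 = z2 * w1 / z1 & z4 = z2 * z3 / z1],
      [/\ z1 = 0, w1 != 0, z2 = 0 & z4 = z3 * w2 / w1],
      [/\ z1 = 0, w1 = 0, z3 != 0, w2 = 0 & z2 = 0]
    | [/\ z1 = 0, w1 = 0 & z3 = 0]].
Proof.
move=> e1 e2 e3; have [z10|z10] := eqVneq z1 0; last first.
  constructor 1; split=> //; apply: (mulfI z10); rewrite [RHS]mulrC divfK //; lra.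
subst z1; have [w10|w10] := eqVneq w1 0; last first.
  constructor 2; split=> //; apply: (mulfI w10); first lra.
  by rewrite [RHS]mulrC divfK //; lra.
subst w1; have [z30|z30] := eqVneq z3 0; first by constructor 4.
by constructor 3; split=> //; apply: (mulfI z30); lra.
Qed.

End JacobiSolutions.

(** * The three classifications *)

Lemma bracket_relations_eq (R : realType) (V : vectType R) (br : V -> V -> V)
    (X Y Z W wz zx zy wx wy yx wz' zx' zy' wx' wy' yx' : V) :
  bracket_relations br X Y Z W wz zx zy wx wy yx ->
  wz = wz' -> zx = zx' -> zy = zy' -> wx = wx' -> wy = wy' -> yx = yx' ->
  bracket_relations br X Y Z W wz' zx' zy' wx' wy' yx'.
Proof. by move=> H <- <- <- <- <- <-. Qed.

(** Reduces the equality of two lists of brackets to that of their coefficients,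
which tac proves.  Terms with coefficient zero must be visibly zero. *)
Ltac match_brackets H tac :=
  apply: (bracket_relations_eq H);
  rewrite ?(mulr0, oppr0, scale0r, add0r, addr0, subr0) -?scaleNr;
  repeat match goal with |- _ + _ = _ + _ :> _ => congr (_ + _) end;
  (reflexivity || (congr (_ *: _); tac)).

Section Classification.
Variables (R : realType) (V : vectType R) (br : V -> V -> V) (X Y Z W : V).

(** The condition th1 = 2 a, th2 = - 2 al excludes the solutions of
[jacobi_nondegenerate] with D < 0: it forces D s^2 = 1, and the sign of s is
what distinguishes the two variants of [AK_g5]. *)
Lemma AK_classification (lam al be a b z1 z2 z3 z4 w1 w2 r th1 th2 : R) :
  adapted_brackets br X Y Z W lam al be a b z1 z2 z3 z4 w1 w2 r th1 th2 ->
  jacobi_equations lam al be a b z1 z2 z3 z4 w1 w2 r th1 th2 ->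
  reduced lam al be a b ->
  th1 = 2 * a -> th2 = - (2 * al) ->
  AK_family br X Y Z W.
Proof.
move=> H jac tri th1E th2E; case: tri => [lam0|[lam0 D0]|[lam0 a0 b0]].
- have [[a0 b0 _] [[z10 z30 z40] cases]] := jacobi_nonabelian_leaf jac lam0.
  case: cases => [[_ z20 ral rbe rw1]|[alE be0 rE eq2]].
    have [r0|r0] := eqVneq r 0; last first.
      have al0 : al = 0 by apply: (mulfI r0); rewrite ral mulr0.
      have be0 : be = 0 by apply: (mulfI r0); rewrite rbe mulr0.
      have w10 : w1 = 0 by apply: (mulfI r0); move: rw1; rewrite th2E al0; lra.
      by clear rw1; subst; apply: (AK_g1 lam0 r0); match_brackets H ring.
    have [al0|al0] := eqVneq al 0.
      by subst; apply: (AK_g2 (be := be) (w1 := w1) (w2 := w2) lam0);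
        match_brackets H ring.
    have lamE : lam = - (2 * al).
      by apply: (mulIf al0); move: rw1; rewrite r0 th2E; lra.
    by subst; apply: (AK_g3 (be := be) (w1 := w1) (w2 := w2) al0);
      match_brackets H ring.
  have z2w1 : z2 * w1 = 2 * lam ^+ 2 by move: eq2; rewrite th2E alE; lra.
  have z20 : z2 != 0.
    apply: contra_neq lam0 => z20; apply/eqP; rewrite -sqrf_eq0; apply/eqP.
    by move: z2w1; rewrite z20; lra.
  subst; apply: (AK_g4 (w2 := w2) lam0 z20).
  match_brackets H ltac:(try ring).
  by apply: (mulfI z20); rewrite z2w1; field.
- subst lam; have [s [rE E1 E2 [Ez1 Ez2 [Ez3 Ez4 Ew1 Ew2]]]] :=
    jacobi_nondegenerate jac D0.
  set D := al * b - a * be in D0 rE E1 E2.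
  have Ds : D * s ^+ 2 = 1.
    have al0 : al * (D * s ^+ 2 - 1) = 0 by lra.
    have a0 : a * (D * s ^+ 2 - 1) = 0 by lra.
    apply/eqP; rewrite -subr_eq0; apply/eqP/(mulfI D0); rewrite mulr0.
    have -> : D * (D * s ^+ 2 - 1) =
      b * (al * (D * s ^+ 2 - 1)) - be * (a * (D * s ^+ 2 - 1)).
      by rewrite {1}/D; ring.
    by rewrite al0 a0; ring.
  have Dpos : 0 < D.
    have s0 : s != 0.
      by apply/eqP => s0; move: Ds; rewrite s0; lra.
    by rewrite -(pmulr_lgt0 D (_ : 0 < s ^+ 2)) ?Ds // exprn_even_gt0.
  have q0 : Num.sqrt D != 0 by rewrite gt_eqF ?sqrtr_gt0.
  have q2 : Num.sqrt D ^+ 2 = D by rewrite sqr_sqrtr ?ltW.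
  have [e sE] : exists e : bool, s = (-1) ^+ e / Num.sqrt D.
    have : (s * Num.sqrt D) ^+ 2 == 1 by rewrite exprMn q2 mulrC Ds.
    rewrite sqrf_eq1 => /orP[] /eqP E; [exists false | exists true];
      by apply: (mulIf q0); rewrite E divfK ?expr0.
  have rF : r = (-1) ^+ e * (2 * Num.sqrt D).
    by rewrite rE sE -{1}q2; field.
  apply: (@AK_g5 _ _ _ _ _ _ _ e al a be b Dpos).
  match_brackets H ltac:(rewrite ?Ez1 ?Ez2 ?Ez3 ?Ez4 ?Ew1 ?Ew2 ?rF ?th1E ?th2E ?sE; ring).
- subst lam a b; have [p0|p0] := eqVneq (al ^+ 2 + be ^+ 2) 0; last first.
    have [z10 z20 z30 z40 [r0 _ alth2]] := jacobi_degenerate jac p0.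
    have al0 : al = 0.
      by apply/eqP; rewrite -sqrf_eq0; apply/eqP; move: alth2; rewrite th2E; lra.
    have be0 : be != 0.
      by apply: contra_neq p0 => be0; rewrite al0 be0; ring.
    by subst; apply: (AK_g16 (w1 := w1) (w2 := w2) be0); match_brackets H ring.
  have [al0 be0] := sum_sqr_eq0 p0; clear p0; subst.
  case: jac => _ _ _ _ _ _ _ _ e8 e9 _ _ e12 _.
  have {}e8 : r * z1 = w2 * z3 - w1 * z4 by lra.
  have {}e9 : r * w1 = 2 * (z2 * w1 - z1 * w2) by lra.
  have {}e12 : r * z3 = 2 * (z1 * z4 - z2 * z3) by lra.
  have [r0|r0] := eqVneq r 0.
    rewrite r0 !mul0r in e8 e9 e12; subst r.
    have {}e9 : 0 = z2 * w1 - z1 * w2 by lra.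
    have {}e12 : 0 = z1 * z4 - z2 * z3 by lra.
    case: (jacobi_vertical_abelian e8 e9 e12).
    + case=> z10 w2E z4E; subst.
      apply: (AK_g11 (z2 := z2) (z3 := z3) (w1 := w1) z10); match_brackets H ring.
    + case=> z10 w10 z20 z4E; subst.
      by apply: (AK_g12 (z3 := z3) (w2 := w2) w10); match_brackets H ring.
    + case=> z10 w10 z30 w20 z20; subst.
      by apply: (AK_g13 (z4 := z4) z30); match_brackets H ring.
    + case=> z10 w10 z30; subst.
      by apply: (AK_g14 (z2 := z2) (z4 := z4) (w2 := w2)); match_brackets H ring.
  case: (jacobi_vertical_solvable e8 e9 e12 r0).
  + case=> z10 z30 w1E w2E z4E; subst.
    by apply: (AK_g6 (z2 := z2) z10 z30 r0); match_brackets H ring.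
  + case=> z10 z30 w10 z40 rE.
    have z20 : z2 != 0 by apply: contra_neq r0 => z20; rewrite rE z20; ring.
    by subst; apply: (AK_g7 (w2 := w2) z20 w10); match_brackets H ring.
  + case=> z10 w10 z30 w20 rE.
    have z20 : z2 != 0 by apply: contra_neq r0 => z20; rewrite rE z20; ring.
    by subst; apply: (AK_g9 (z4 := z4) z20 z30); match_brackets H ring.
  + case=> z10 w10 z30; subst.
    by apply: (AK_g8 (z2 := z2) (z4 := z4) (w2 := w2) r0); match_brackets H ring.
Qed.

(** In complex notation the hypotheses say v + t = 2 i u.  For the solutions of
[jacobi_nondegenerate] this is s (q' - i p')^2 = 0, so that s = 0 or
q = - i p. *)
Lemma I_classification (lam al be a b z1 z2 z3 z4 w1 w2 r th1 th2 : R) :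
  adapted_brackets br X Y Z W lam al be a b z1 z2 z3 z4 w1 w2 r th1 th2 ->
  jacobi_equations lam al be a b z1 z2 z3 z4 w1 w2 r th1 th2 ->
  reduced lam al be a b ->
  z4 = 2 * z1 - w2 -> w1 + z3 + 2 * z2 = 0 ->
  I_family br X Y Z W.
Proof.
move=> H jac tri z4I w1I; case: tri => [lam0|[lam0 D0]|[lam0 a0 b0]].
- have [[a0 b0 th10] [[z10 z30 z40] cases]] := jacobi_nonabelian_leaf jac lam0.
  case: cases => [[p0 z20 ral rbe rw1]|[alE be0 rE eq2]].
    have w10 : w1 = 0 by lra.
    have w20 : w2 = 0 by lra.
    have [r0|r0] := eqVneq r 0; last first.
      have al0 : al = 0 by apply: (mulfI r0); rewrite ral mulr0.
      have be0 : be = 0 by apply: (mulfI r0); rewrite rbe mulr0.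
      have th20 : th2 = 0 by apply: (mulfI lam0); move: rw1; rewrite w10 al0; lra.
      by clear rw1 z4I; subst; apply: (I_g1 lam0 r0); match_brackets H ring.
    have [th20|th20] := eqVneq th2 0.
      by clear z4I; subst; apply: (I_g2 lam0 p0); match_brackets H ring.
    have lamE : lam = - (2 * al).
      by apply: (mulIf th20); move: rw1; rewrite w10; lra.
    have al0 : al != 0 by apply: contra_neq lam0 => al0; rewrite lamE al0; ring.
    by clear z4I; subst; apply: (I_g3 (be := be) al0 th20); match_brackets H ring.
  have w1E : w1 = - (2 * z2) by lra.
  have w20 : w2 = 0 by lra.
  have th2E : th2 = 2 * z2 ^+ 2 / lam.
    by apply: (mulfI lam0); rewrite [RHS]mulrC divfK //; move: eq2; rewrite w1E; lra.
  by clear z4I; subst; apply: (I_g4 (z2 := z2) lam0); match_brackets H ring.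
- subst lam; have [s [rE E1 E2 [Ez1 Ez2 [Ez3 Ez4 Ew1 Ew2]]]] :=
    jacobi_nondegenerate jac D0.
  set D := al * b - a * be in D0 rE E1 E2.
  have [s0|s0] := eqVneq s 0.
    move: rE E1 E2 Ez1 Ez2 Ez3 Ez4 Ew1 Ew2.
    rewrite s0 expr0n /= !mulr0 !mul0r !oppr0 => *; clear z4I; subst.
    by apply: (I_g10 D0); match_brackets H ring.
  (* The square of (a - be) - i (b + al), the complex number q' - i p', vanishes. *)
  have mn : (a - be) * (b + al) = 0.
    by apply: (mulfI s0); move: z4I; rewrite Ez4 Ez1 Ew2; lra.
  have m2n2 : (a - be) ^+ 2 - (b + al) ^+ 2 = 0.
    by apply: (mulfI s0); move: w1I; rewrite Ez2 Ez3 Ew1; lra.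
  have /sum_sqr_eq0[aE bE] : (a - be) ^+ 2 + (b + al) ^+ 2 = 0.
    apply/eqP; rewrite -sqrf_eq0; apply/eqP.
    have -> : ((a - be) ^+ 2 + (b + al) ^+ 2) ^+ 2 =
      ((a - be) ^+ 2 - (b + al) ^+ 2) ^+ 2 + 4 * ((a - be) * (b + al)) ^+ 2.
      by ring.
    by rewrite m2n2 mn; ring.
  have {}aE : a = be by lra.
  have {}bE : b = - al by lra.
  have DE : D = - (al ^+ 2 + be ^+ 2) by rewrite /D aE bE; ring.
  have S0 : al ^+ 2 + be ^+ 2 != 0 by rewrite -oppr_eq0 -DE.
  have sE : s = - (r / (2 * (al ^+ 2 + be ^+ 2))) by rewrite rE DE; field.
  have r0 : r != 0 by rewrite rE !mulf_neq0 ?pnatr_eq0.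
  apply: (@I_g5 _ _ _ _ _ _ _ al be r r0 S0).
  rewrite aE bE sE DE {w1I z4I} in E1 E2 Ez1 Ez2 Ez3 Ez4 Ew1 Ew2.
  rewrite E1 E2 Ez1 Ez2 Ez3 Ez4 Ew1 Ew2 aE bE in H.
  by match_brackets H ltac:(field).
- subst lam a b; have [p0|p0] := eqVneq (al ^+ 2 + be ^+ 2) 0; last first.
    have [z10 z20 z30 z40 [r0 alth1 alth2]] := jacobi_degenerate jac p0.
    have w10 : w1 = 0 by lra.
    have w20 : w2 = 0 by lra.
    have [al0|al0] := eqVneq al 0.
      have be0 : be != 0 by apply: contra_neq p0 => be0; rewrite al0 be0; ring.
      clear z4I; subst.
      by apply: (I_g16 (th1 := th1) (th2 := th2) be0); match_brackets H ring.
    have th10 : th1 = 0 by apply: (mulfI al0); rewrite alth1 mulr0.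
    have th20 : th2 = 0 by apply: (mulfI al0); rewrite alth2 mulr0.
    have [be0|be0] := eqVneq be 0.
      by clear z4I; subst; apply: (I_g15 al0); match_brackets H ring.
    by clear z4I; subst; apply: (I_g19 al0 be0); match_brackets H ring.
  have [al0 be0] := sum_sqr_eq0 p0; clear p0; subst al be.
  case: jac => _ _ _ _ _ _ _ _ e8 e9 _ _ e12 _.
  have {}e8 : r * z1 = w2 * z3 - w1 * z4 by lra.
  have {}e9 : r * w1 = 2 * (z2 * w1 - z1 * w2) by lra.
  have {}e12 : r * z3 = 2 * (z1 * z4 - z2 * z3) by lra.
  have [r0|r0] := eqVneq r 0.
    rewrite r0 !mul0r in e8 e9 e12; subst r.
    have {}e9 : 0 = z2 * w1 - z1 * w2 by lra.
    have {}e12 : 0 = z1 * z4 - z2 * z3 by lra.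
    case: (jacobi_vertical_abelian e8 e9 e12).
    + case=> z10 _ _; have : z1 ^+ 2 + z2 ^+ 2 = 0.
        have z3E : z3 = - w1 - 2 * z2 by lra.
        by move: e9 e12; rewrite z4I z3E; lra.
      by case/sum_sqr_eq0 => z1E; rewrite z1E eqxx in z10.
    + case=> z10 w10 z20 _.
      have z3E : z3 = - w1 by lra.
      have z4E : z4 = - w2 by lra.
      clear z4I w1I; subst.
      by apply: (I_g12 (w2 := w2) (th1 := th1) (th2 := th2) w10); match_brackets H ring.
    + by case=> z10 w10 z30 w20 z20; case/eqP: z30; lra.
    + case=> z10 w10 z30.
      have z20 : z2 = 0 by lra.
      have z4E : z4 = - w2 by lra.
      clear z4I w1I; subst.
      by apply: (I_g14 (w2 := w2) (th1 := th1) (th2 := th2)); match_brackets H ring.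
  case: (jacobi_vertical_solvable e8 e9 e12 r0).
  + case=> z10 z30 w1E w2E z4E.
    have z2E : z2 = (z1 ^+ 2 - z3 ^+ 2) / (2 * z3).
      apply: (mulIf (_ : 2 * z3 != 0)); first by rewrite mulf_neq0 ?pnatr_eq0.
      rewrite divfK ?mulf_neq0 ?pnatr_eq0 //.
      have -> : z2 * (2 * z3) = - (w1 + z3) * z3 by rewrite (_ : w1 = - z3 - 2 * z2); lra.
      by rewrite w1E; field.
    have N0 : z1 ^+ 2 + z3 ^+ 2 != 0.
      by apply: contra_neq z30 => /sum_sqr_eq0[].
    have rE : r = (z1 ^+ 2 + z3 ^+ 2) / z3.
      apply: (mulfI N0).
      have : 2 * z1 * z3 * (z4 + w2) = 2 * z1 * z3 * (2 * z1) by rewrite z4I; ring.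
      rewrite w2E z4E.
      have -> : 2 * z1 * z3 * (z3 * (r + 2 * z2) / (2 * z1) +
          z1 * (r - 2 * z2) / (2 * z3)) =
          (z1 ^+ 2 + z3 ^+ 2) * r + 2 * z2 * (z3 ^+ 2 - z1 ^+ 2).
        by field; rewrite z10 z30.
      move=> E; have -> : (z1 ^+ 2 + z3 ^+ 2) * r =
        4 * z1 ^+ 2 * z3 - 2 * z2 * (z3 ^+ 2 - z1 ^+ 2) by lra.
      by rewrite z2E; field.
    have w2z1 : w2 = z1 by rewrite w2E z2E rE; field.
    have z4z1 : z4 = z1 by rewrite z4I w2z1; ring.
    clear z4I w1I w2E z4E e8 e9 e12; subst.
    by apply: (I_g6 (th1 := th1) (th2 := th2) z10 z30); match_brackets H ring.
  + case=> z10 z30 w10 z40 rE.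
    have z20 : z2 != 0 by apply: contra_neq r0 => z20; rewrite rE z20; ring.
    have w1E : w1 = - (2 * z2) by lra.
    have w2E : w2 = 0 by lra.
    clear z4I w1I; subst.
    by apply: (I_g7 (th1 := th1) (th2 := th2) z20); match_brackets H ring.
  + case=> z10 w10 z30 w20 rE.
    have z20 : z2 != 0 by apply: contra_neq r0 => z20; rewrite rE z20; ring.
    have z3E : z3 = - (2 * z2) by lra.
    have z4E : z4 = 0 by lra.
    clear z4I w1I; subst.
    by apply: (I_g9 (th1 := th1) (th2 := th2) z20); match_brackets H ring.
  + case=> z10 w10 z30.
    have z20 : z2 = 0 by lra.
    have z4E : z4 = - w2 by lra.
    clear z4I w1I; subst.
    by apply: (I_g8 (w2 := w2) (th1 := th1) (th2 := th2) r0); match_brackets H ring.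
Qed.

End Classification.

Section KahlerClassification.
Variables (R : realType) (V : vectType R) (br : {bilinear V -> V -> V}).
Variables (g : {dot V for idfun}) (k : {vspace V}) (J : 'End(V)).
Variables (X Y Z W : V).
Hypotheses (herm : almost_hermitian g J) (lie : lie_bracket br).
Hypothesis ab : adapted_basis g k J X Y Z W.

(** In each integrable family the two almost Kähler equations involve only the
vertical part of [Y, X] and the scaling parts al, a of the similarities.
In [I_g4] and [I_g5] the equations have no solution, as they equate a
nonnegative number with a negative one; in [I_g10], [I_g15], [I_g17], [I_g19]
and [I_g20] they force al = 0 and a = 0, because [Y, X] = 0. *)
Lemma K_of_I_family : almost_kahler br g J -> I_family br X Y Z W ->
  K_family br X Y Z W.
Proof.
move=> ak; have [akW akZ] := almost_kahler_bracket herm lie ab ak.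
have G := adapted_basis_gram ab.
have gD u v w : g (u + v) w = g u w + g v w by rewrite linearDl.
have gS c u w : g (c *: u) w = c * g u w by rewrite linearZl_LR.
have gN u w : g (- u) w = - g u w by rewrite linearNl.
have g0 w : g 0 w = 0 by rewrite linear0l.
have coords wz zx zy wx wy yx : bracket_relations br X Y Z W wz zx zy wx wy yx ->
    g yx W = - g zx X - g zy Y /\ g yx Z = g wx X + g wy Y.
  by case=> [[_ <-] [[<- <-] [<- <-]]].
case=> [lam r lam0 r0|lam al be lam0 p0|al be th2 al0 th20|lam z2 lam0
  |al be r S r0 S0|z1 z3 th1 th2 z10 z30|z2 th1 th2 z20|w2 r th1 th2 r0
  |z2 th1 th2 z20|al a be b D0|w1 w2 th1 th2 w10|w2 th1 th2|al al0
  |be th1 th2 be0|al a al0 a0|be b th1 th2 be0 b0|al be al0 be0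
  |al a be al0 a0 be0] H; have [akW' akZ'] := coords _ _ _ _ _ _ H.
all: rewrite !(gD, gS, gN, g0) !G in akW' akZ'.
all: clear akW akZ coords gD gS gN g0 G.
- by apply: (K_g1 lam0 r0).
- have al0 : al = 0 by lra.
  by subst; apply: (K_g2 (be := be) lam0); match_brackets H ring.
- have th2E : th2 = - (2 * al) by lra.
  by subst; apply: (K_g3 (be := be) al0); match_brackets H ring.
- have : 2 * lam ^+ 2 + 2 * z2 ^+ 2 = 0.
    have -> : 2 * z2 ^+ 2 = lam * (2 * z2 ^+ 2 / lam) by field.
    have -> : 2 * z2 ^+ 2 / lam = - (2 * lam) by lra.
    by ring.
  have := sqr_ge0 z2; have : 0 < lam ^+ 2 by rewrite exprn_even_gt0.
  by lra.
- have S_gt0 : 0 < S by rewrite lt0r S0 addr_ge0 ?sqr_ge0.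
  have c0 : r ^+ 2 / (2 * S) + 2 != 0.
    by rewrite gt_eqF // ltr_wpDl // divr_ge0 ?sqr_ge0 // mulr_ge0 // ltW.
  have be0 : be = 0.
    apply: (mulfI c0); rewrite mulr0 mulrDl.
    have -> : r ^+ 2 / (2 * S) * be = be * r ^+ 2 / (2 * S) by ring.
    by lra.
  have al0 : al = 0.
    apply: (mulfI c0); rewrite mulr0 mulrDl.
    have -> : r ^+ 2 / (2 * S) * al = al * r ^+ 2 / (2 * S) by ring.
    by lra.
  by move/eqP: S0; rewrite /S al0 be0; case; ring.
- have th10 : th1 = 0 by lra.
  have th20 : th2 = 0 by lra.
  by subst; apply: (K_g6 z10 z30); match_brackets H ring.
- have th10 : th1 = 0 by lra.
  have th20 : th2 = 0 by lra.
  by subst; apply: (K_g7 z20); match_brackets H ring.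
- have th10 : th1 = 0 by lra.
  have th20 : th2 = 0 by lra.
  by subst; apply: (K_g8 (w2 := w2) r0); match_brackets H ring.
- have th10 : th1 = 0 by lra.
  have th20 : th2 = 0 by lra.
  by subst; apply: (K_g9 z20); match_brackets H ring.
- have al0 : al = 0 by lra.
  have a0 : a = 0 by lra.
  by case/eqP: D0; rewrite al0 a0; ring.
- have th10 : th1 = 0 by lra.
  have th20 : th2 = 0 by lra.
  by subst; apply: (K_g12 (w2 := w2) w10); match_brackets H ring.
- have th10 : th1 = 0 by lra.
  have th20 : th2 = 0 by lra.
  by subst; apply: (K_g14 (w2 := w2)); match_brackets H ring.
- by case/eqP: al0; lra.
- have th10 : th1 = 0 by lra.
  have th20 : th2 = 0 by lra.
  by subst; apply: (K_g16 be0); match_brackets H ring.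
- by case/eqP: al0; lra.
- have th10 : th1 = 0 by lra.
  have th20 : th2 = 0 by lra.
  by subst; apply: (K_g18 be0 b0); match_brackets H ring.
- by case/eqP: al0; lra.
- by case/eqP: al0; lra.
Qed.

End KahlerClassification.

Theorem theorem1p2 (R : realType) (V : vectType R)
    (br : {bilinear V -> V -> V}) (g : {dot V for idfun})
    (nabla : {bilinear V -> V -> V}) (k : {vspace V}) (J : 'End(V)) :
  \dim {:V} = 4%N ->
  lie_bracket br ->
  levi_civita br g nabla ->
  \dim k = 2%N ->
  subalgebra br k ->
  conformal_foliation g nabla k ->
  minimal_leaves g nabla k ->
  almost_hermitian g J ->
  adapted g k J ->
  [/\ almost_kahler br g J ->
        exists X Y Z W, adapted_basis g k J X Y Z W /\ AK_family br X Y Z W,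
      integrable br J ->
        exists X Y Z W, adapted_basis g k J X Y Z W /\ I_family br X Y Z W
    & kahler br g J ->
        exists X Y Z W, adapted_basis g k J X Y Z W /\ K_family br X Y Z W].
Proof.
move=> dimV lie lc dimk subk conf mini herm adJ.
have [X [Y [Z [W]]]] :=
  adapted_brackets_exist dimV dimk herm adJ lie lc subk conf mini.
case=> lam [al [be [a [b [z1 [z2 [z3 [z4 [w1 [w2 [r [th1 [th2]]]]]]]]]]]]].
case=> ab H red; have jac := jacobi_of_brackets lie ab H.
have C := adapted_brackets_coords ab H.
have I_fam : integrable br J -> I_family br X Y Z W.
  move=> /(integrable_bracket herm ab); rewrite !C => -[e1 e2].
  by apply: (I_classification H jac red); lra.
split=> [ak|/I_fam fam|[ak /I_fam fam]]; exists X, Y, Z, W; split=> //.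
  have := almost_kahler_bracket herm lie ab ak; rewrite !C => -[e1 e2].
  by apply: (AK_classification H jac red); lra.
exact: (K_of_I_family herm lie ab ak fam).
Qed.
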